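(* Let $c\in\{0,N\}$, and put $a=1$, $r=1$ if $c=0$, and $a=N$, $r=N-1$ if $c=N$. Let $(y_k)_{k\in[0,N]\setminus\{c\}}$ be a zero-mean nonsingular Gaussian (ZMNG) Markov sequence of $\mathbb{R}^d$-valued vectors with $$y_k=U_{k,k-1}y_{k-1}+e_k,\quad k\in[1,N]\setminus\{a\},$$ where $(e_k)_{k\in[0,N]\setminus\{c\}}$ is a zero-mean white nonsingular Gaussian sequence with covariances $U_k$ (with $e_1=y_1$ if $c=0$, and $e_0=y_0$ if $c=N$). Let $x_c$ be a ZMNG vector with covariance $C_c$ that is uncorrelated with $(y_k)_{k\in[0,N]\setminus\{c\}}$, and let $[x_k]$ be constructed as $$x_k=y_k+\Gamma_kx_c,\quad k\in[0,N]\setminus\{c\},$$ where $\Gamma_k$ are some ($d\times d$) matrices. Then $[x_k]$ is reciprocal if and only if, for all $k\in[1,N-1]\setminus\{r\}$, $$U_k^{-1}(\Gamma_k-U_{k,k-1}\Gamma_{k-1})=U_{k+1,k}'U_{k+1}^{-1}(\Gamma_{k+1}-U_{k+1,k}\Gamma_k).\qquad(\ast)$$ Moreover, $[x_k]$ is Markov if and only if, in addition to $(\ast)$, we have $$U_0^{-1}\Gamma_0=U_{1,0}'U_1^{-1}(\Gamma_1-U_{1,0}\Gamma_0)\quad\text{if } c=N,$$ $$\Gamma_N-U_{N,N-1}\Gamma_{N-1}=0\quad\text{if } c=0.$$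
   Context: $N\ge2$ is an integer and $[i,j]=\{i,i+1,\ldots,j\}$; $[x_k]$ denotes $(x_k)_{k\in[0,N]}$. The prime denotes matrix transposition. For $c=N$ the index set $[0,N]\setminus\{c\}$ is $[0,N-1]$, and for $c=0$ it is $[1,N]$. A sequence (or vector) is zero-mean nonsingular Gaussian (ZMNG) if the stacked vector of all its terms is jointly Gaussian with zero mean and nonsingular covariance matrix ($x_c$ and the $y_k$ are jointly Gaussian). A zero-mean white nonsingular Gaussian sequence is a jointly Gaussian, zero-mean sequence whose terms are mutually uncorrelated, each with nonsingular covariance. A sequence is Markov if, conditioned on the state at any time $k$, the segment before $k$ is independent of the segment after $k$. A sequence $[x_k]$ is reciprocal if, conditioned on the states at any two times $j<l$, the segment inside $(j,l)$ is independent of the two segments outside $[j,l]$; equivalently, the conditional distribution of $x_k$ given $(x_0,\ldots,x_j,x_l,\ldots,x_N)$ equals that given $(x_j,x_l)$ for all $j<k<l$ in $[0,N]$. *)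

(* Defs.v *)
From HB Require Import structures.
From mathcomp Require Import all_boot all_order all_algebra.
From mathcomp Require Import all_classical all_reals all_analysis.

Set Implicit Arguments.
Unset Strict Implicit.
Unset Printing Implicit Defensive.

Import Order.TTheory GRing.Theory Num.Theory.
Import numFieldNormedType.Exports.

Local Open Scope classical_set_scope.
Local Open Scope ring_scope.

Section random_vectors.
Context (disp : measure_display) (T : measurableType disp) (R : realType).
Variable P : probability T R.

(* [normal_prob m 0] is not a point mass in the library, so the degenerate
   Gaussian law N(m, 0) is given separately. *)
Definition gaussian_rv (X : T -> R) : Prop :=
  measurable_fun [set: T] X /\
  exists m s : R, forall B : set R, measurable B ->
    P (X @^-1` B) = if s == 0 then \d_m B else normal_prob m s B.

(* Every linear combination of the entries is univariate Gaussian. *)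
Definition gaussian_vec (n : nat) (X : T -> 'cV[R]_n) : Prop :=
  forall w : 'rV[R]_n, gaussian_rv (fun t => (w *m X t) 0 0).

Definition zero_mean (n : nat) (X : T -> 'cV[R]_n) : Prop :=
  forall i, ('E_P[fun t => X t i 0%R] = 0)%E.

(* The entries are finite for the square-integrable vectors (in particular the
   Gaussian ones) that this is applied to, so that [fine] loses nothing. *)
Definition cov_mx (m n : nat) (X : T -> 'cV[R]_m) (Y : T -> 'cV[R]_n) :
    'M[R]_(m, n) :=
  \matrix_(i, j) fine (covariance P (fun t => X t i 0) (fun t => Y t j 0)).

Definition uncorrelated (m n : nat) (X : T -> 'cV[R]_m) (Y : T -> 'cV[R]_n) :
  Prop := cov_mx X Y = 0.

Definition zmng (n : nat) (X : T -> 'cV[R]_n) : Prop :=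
  [/\ gaussian_vec X, zero_mean X & cov_mx X X \in unitmx].

(* [G] is a sub-sigma-algebra and [f] is a version of P(A | G). *)
Definition is_cond_prob (G : set (set T)) (A : set T) (f : T -> R) : Prop :=
  [/\ forall B : set R, measurable B -> G (f @^-1` B),
      P.-integrable [set: T] (EFin \o f) &
      forall C, G C -> (\int[P]_(t in C) (f t)%:E = P (A `&` C))%E].

(* P(A `&` B | G) = P(A | G) P(B | G) almost surely for A in F1 and B in F2.
   Versions of conditional probabilities exist and are almost surely unique, so
   the existential quantifiers could equally well be universal. *)
Definition cond_indep (F1 F2 G : set (set T)) : Prop :=
  forall A B, F1 A -> F2 B -> exists f g : T -> R,
    [/\ is_cond_prob G A f, is_cond_prob G B g &
        is_cond_prob G (A `&` B) (f \* g)].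

(* A sequence is a function on [nat] of which only the terms with an index in a
   finite list [s] matter. *)
Section sequences.
Variable d : nat.
Implicit Types (s : seq nat) (x : nat -> T -> 'cV[R]_d).

Definition stack s x (t : T) : 'cV[R]_(\sum_(p < size s) d) :=
  \mxcol_(p < size s) x (nth 0%N s p) t.

Definition zmng_seq s x : Prop := zmng (stack s x).

Definition white_zmng_seq s x : Prop :=
  [/\ gaussian_vec (stack s x),
      zero_mean (stack s x),
      {in s &, forall k l, k != l -> uncorrelated (x k) (x l)} &
      {in s, forall k, cov_mx (x k) (x k) \in unitmx}].

Definition sigma_seq (J : set nat) x : set (set T) :=
  <<s \bigcup_(k in J) \bigcup_(i in [set: 'I_d])
        preimage_set_system [set: T] (fun t => x k t i 0) measurable >>.

Definition markov_seq s x : Prop :=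
  {in s, forall k,
    cond_indep (sigma_seq [set i | i \in s /\ (i < k)%N] x)
               (sigma_seq [set i | i \in s /\ (k < i)%N] x)
               (sigma_seq [set k] x)}.

Definition reciprocal_seq s x : Prop :=
  {in s &, forall j l, (j < l)%N ->
    cond_indep (sigma_seq [set i | i \in s /\ (j < i < l)%N] x)
               (sigma_seq [set i | i \in s /\ ((i < j)%N \/ (l < i)%N)] x)
               (sigma_seq [set j; l] x)}.

End sequences.
End random_vectors.

Definition times (N : nat) : seq nat := index_iota 0 N.+1.

Definition times_but (N c : nat) : seq nat := [seq k <- times N | k != c].

(* Main.v *)
(* Stack [x_c] and the [y_k] into one centered Gaussian vector [Z]; every [x_k] is a
   linear image of [Z], and linear images carry the positive semidefinite bilinear
   form given by the covariance of [Z].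

   Gaussian conditional independence is a statement about this form: the past and the
   future are conditionally independent given the present iff the residual of the
   future, after projection on the span of the present, is orthogonal to the past.
   This rests on the independence of the sigma-algebras of two orthogonal Gaussian
   spaces.  Uncorrelated jointly Gaussian [X], [Y] satisfy
   E cos X cos Y = E cos X E cos Y and the analogous sine identities, because
   X + Y and X - Y have the same normal law; polynomials in sin (u X) approximate the
   indicators of half-lines, and the pi-lambda theorem does the rest.

   Let [Xh k] be the k-th block row of the inverse covariance of [x], applied to [x],
   so that [Xh k] and [x j] have covariance 1 if k = j and 0 otherwise.  It is a
   combination of x_(k-1), x_k, x_(k+1) plus a matrix multiple of x_c, and the
   coefficient of x_c vanishes exactly when the stated identity holds at k.
   Reciprocality means that, for 0 < k < N, [Xh k] involves only the neighbours of
   x_k, so that the coefficient must vanish unless x_c is itself such a neighbour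
   (k = r).  The Markov property requires the same at the end of the sequence opposite
   to c. *)
Require Import Defs.
From HB Require Import structures.
From mathcomp Require Import all_boot all_order all_algebra.
From mathcomp Require Import all_classical all_reals all_analysis.
From mathcomp Require Import measurable_realfun zify ring lra.

Set Implicit Arguments.
Unset Strict Implicit.
Unset Printing Implicit Defensive.

Import Order.TTheory GRing.Theory Num.Theory.
Import numFieldNormedType.Exports.

Local Open Scope classical_set_scope.
Local Open Scope ring_scope.

(** * The normal law *)

(** Conditional independence is first made one-sided: a version of P(A | present) must also be a
    version of P(A | future, present), which is tested on intersections of an event of the future
    with one of the present. Replacing the future by its residuals then leaves ordinary
    independence: residuals and present generate the same sigma-algebra as future and present, and
    the residuals are independent of past and present taken together.

    The covariance form is handled as a semidefinite one. Gram matrices of spans may be singular, so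
    projections come from an inclusion of kernels. The only matrices inverted are the U_k and the
    covariance of x_c; the rows of the inverse covariance of x are written down from the noises, as
    U_k^-1 e_k - U_{k+1,k}' U_{k+1}^-1 e_{k+1} (without the second term at the last index), and
    checked to be biorthogonal to the states. No such row is written for x_c, hence the side that is
    expanded in these rows is always the one without x_c. *)

Lemma ge0_integral_density d (T : measurableType d) (R : realType)
    (nu : {finite_measure set T -> \bar R})
    (mu : {sigma_finite_measure set T -> \bar R}) (k F : T -> R) :
  mu.-integrable setT (EFin \o k) ->
  (forall C, measurable C -> nu C = (\int[mu]_(t in C) (k t)%:E)%E) ->
  measurable_fun setT F -> (forall x, 0 <= F x) ->
  (\int[nu]_t (F t)%:E = \int[mu]_t (F t * k t)%:E)%E.
Proof.
move=> ik nuE mF F0.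
have mk : measurable_fun setT k by apply/measurable_EFinP; exact: measurable_int ik.
have numu : nu `<< mu.
  apply/null_content_dominatesP => A mA A0; rewrite nuE//.
  apply: null_set_integral => //; exact/measurable_EFinP/measurable_funTS.
rewrite -(Radon_Nikodym_SigmaFinite.change_of_variables numu) //=; last first.
  exact/measurable_EFinP.
(* [k] and the Radon-Nikodym derivative have the same integral over every measurable set, hence
   agree almost everywhere. *)
apply: ae_eq_integral => //.
- apply: emeasurable_funM; first exact/measurable_EFinP.
  exact: measurable_int (Radon_Nikodym_SigmaFinite.f_integrable numu).
- exact/measurable_EFinP/measurable_funM.
- under [X in ae_eq _ _ _ X]eq_fun do rewrite EFinM.
  apply: ae_eqe_mul2l; apply: integral_ae_eq => //.
  + exact: Radon_Nikodym_SigmaFinite.f_integrable.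
  + exact/measurable_EFinP.
  + by move=> E _ mE; rewrite -Radon_Nikodym_SigmaFinite.f_integral// nuE.
Qed.

Section normal_law.
Variable R : realType.
Local Notation mu := (@lebesgue_measure R).
Implicit Types (m s t : R) (F : R -> R).

Lemma ge0_integral_normal_prob m s F :
  measurable_fun setT F -> (forall x, 0 <= F x) ->
  (\int[normal_prob m s]_x (F x)%:E =
   \int[mu]_x (F x * normal_pdf m s x)%:E)%E.
Proof.
move=> mF F0; apply: ge0_integral_density => //.
exact: integrable_normal_pdf.
Qed.

(** Gaussian laws come with an s of either sign, whereas the affine substitution below is increasing
    only for s > 0. *)
Lemma normal_pdf_abs m s : normal_pdf m `|s| = normal_pdf m s.
Proof.
apply/funext => x; rewrite /normal_pdf /normal_peak /normal_fun normr_eq0.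
by rewrite real_normK ?num_real.
Qed.

Lemma normal_pdf_affine m s x : 0 < s ->
  normal_pdf m s (m + s * x) * s = normal_pdf 0 1 x.
Proof.
move=> s0; rewrite !normal_pdfE ?gt_eqF// /normal_peak /normal_fun.
rewrite subr0 (addrC m) addrK -mulrAC expr1n.
have -> : s ^+ 2 * pi *+ 2 = s ^+ 2 * (1 * pi *+ 2) by rewrite mul1r mulrnAr.
rewrite sqrtrM ?sqr_ge0// sqrtr_sqr gtr0_norm// invfM.
rewrite [_^-1 * _^-1]mulrC -mulrA; rewrite mulrAC -!mulrA; congr (_ * _).
rewrite mulrCA divff ?gt_eqF// mulr1; congr expR.
field; exact/lt0r_neq0.
Qed.

Lemma ge0_integral_normal_affine m s F : 0 <= s -> s != 0 ->
  continuous F -> (forall x, 0 <= F x) ->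
  (\int[normal_prob m s]_x (F x)%:E =
   \int[normal_prob 0 1]_x (F (m + s * x)%R)%:E)%E.
Proof.
move=> s_ge0 s_neq0 cF F0.
have s0 : 0 < s by rewrite lt_def s_neq0.
(* A translation followed by a scaling, the shape in which the limits at infinity are immediate. *)
pose A (x : R) : R := (x + m / s) * s.
have AE x : A x = m + s * x.
  by rewrite /A mulrDl divfK ?gt_eqF// addrC [x * s]mulrC.
have dA (x : R) : is_derive x 1 A s.
  rewrite /A; apply: is_derive_eq.
  by rewrite scaler0 add0r addr0 /GRing.scale/= mulr1.
have A'E : A^`()%classic = cst s.
  by apply/funext => x; rewrite derive1E derive_val.
have cA : continuous A.
  by move=> x; apply/differentiable_continuous/derivable1_diffP; have [] := dA x.
have cFA : continuous (F \o A).
  by move=> x; apply: continuous_comp; [exact: cA|exact: cF].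
have mF := continuous_measurable_fun cF.
have mFA : measurable_fun setT (fun x => F (m + s * x)).
  rewrite [X in measurable_fun _ X](_ : _ = F \o A).
    exact: continuous_measurable_fun.
  by apply/funext => x /=; rewrite AE.
rewrite !ge0_integral_normal_prob//.
rewrite (increasing_ge0_integration_by_substitutionT (F := A)) ?A'E.
- apply: eq_integral => x _; congr EFin.
  by rewrite !fctE/= !AE -mulrA normal_pdf_affine.
- by move=> x y xy; rewrite /A ltr_pM2r// ltrD2r.
- by move=> x; exact: cvg_cst.
- exact: is_cvg_cst.
- exact: is_cvg_cst.
- by move=> x; have [] := dA x.
- by apply/gt0_cvgMlNy => //; exact: cvg_addrr_Ny.
- by apply/gt0_cvgMly => //; exact: cvg_addrr.
- by move=> x; apply: cvgM; [exact: cF|exact: continuous_normal_pdf].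
- by move=> x; rewrite mulr_ge0// normal_pdf_ge0.
Qed.

(** For z = s x + t y with x, y independent standard normal, both sides are the joint density of (x,
    z): once through the law of z given x, once through the law of x given z, which has mean s z /
    r^2 and deviation t / r. The identity is a completed square. *)
Lemma normal_pdf_convol s t (r x z : R) : 0 < t -> 0 < r -> r ^+ 2 = s ^+ 2 + t ^+ 2 ->
  normal_pdf (s * x) t z * normal_pdf 0 1 x =
  normal_pdf 0 r z * normal_pdf (s * z / r ^+ 2) (t / r) x.
Proof.
move=> t0 r0 rE.
have tr0 : 0 < t / r by rewrite divr_gt0.
rewrite !normal_pdfE ?gt_eqF// /normal_peak /normal_fun.
rewrite mulrACA -expRD [RHS]mulrACA -expRD; congr (_ * expR _).
  rewrite -!invfM -!sqrtrM ?mulrn_wge0 ?mulr_ge0 ?sqr_ge0 ?pi_ge0 ?ltW//.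
  have -> : t ^+ 2 * pi *+ 2 * (1 ^+ 2 * pi *+ 2) =
            r ^+ 2 * pi *+ 2 * ((t / r) ^+ 2 * pi *+ 2) :> R => [|//].
  by move: (pi : R) => p; field; exact/lt0r_neq0.
have s2E : s ^+ 2 = r ^+ 2 - t ^+ 2 by rewrite rE addrK.
have t1 : t != 0 by exact/lt0r_neq0.
have r1 : r != 0 by exact/lt0r_neq0.
rewrite expr1n subr0.
have -> : - (x - s * z / r ^+ 2) ^+ 2 / ((t / r) ^+ 2 *+ 2) =
  - (x ^+ 2 * r ^+ 2 - 2 * s * x * z + s ^+ 2 * z ^+ 2 / r ^+ 2) / (2 * t ^+ 2).
  field; exact/andP.
have -> : - (z - s * x) ^+ 2 / (t ^+ 2 *+ 2) =
  - (z ^+ 2 - 2 * s * x * z + s ^+ 2 * x ^+ 2) / (2 * t ^+ 2).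
  field; exact t1.
rewrite s2E; field; exact/andP.
Qed.

(** At fixed x, z = s x + t y is substituted for y; once the integrals are exchanged, the
    conditional density of x given z integrates to 1. *)
Lemma normal_convol s t (r : R) F :
  0 < s -> 0 < t -> 0 < r -> r ^+ 2 = s ^+ 2 + t ^+ 2 ->
  continuous F -> (forall x, 0 <= F x) ->
  (\int[normal_prob 0 1]_x \int[normal_prob 0 1]_y (F (s * x + t * y)%R)%:E =
   \int[normal_prob 0 1]_z (F (r * z)%R)%:E)%E.
Proof.
move=> s0 t0 r0 rE cF F0.
have mF := continuous_measurable_fun cF.
pose h (xz : R * R) := F xz.2 * normal_pdf (s * xz.1) t xz.2.
have mh : measurable_fun setT h.
  apply: measurable_funM; first exact: measurableT_comp.
  under eq_fun do rewrite normal_pdfE ?gt_eqF//.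
  rewrite /normal_fun; apply: measurable_funM => //.
  apply: measurableT_comp => //; apply: measurable_funM => //.
  apply: measurableT_comp => //; apply: measurable_funX.
  by apply: measurable_funB => //; exact: measurable_funM.
have h0 xz : 0 <= h xz by rewrite mulr_ge0// normal_pdf_ge0.
transitivity (\int[normal_prob 0 1]_x \int[mu]_z (h (x, z))%:E)%E.
  apply: eq_integral => x _.
  rewrite -(ge0_integral_normal_affine (s * x) (ltW t0) (lt0r_neq0 t0) cF F0).
  by rewrite ge0_integral_normal_prob.
rewrite (@fubini_tonelli _ _ _ _ R (normal_prob 0 1) mu (fun xz => (h xz)%:E)) /=; last 2 first.
- exact/measurable_EFinP.
- by move=> xz; rewrite lee_fin.
transitivity (\int[mu]_z (F z * normal_pdf 0 r z)%:E)%E; last first.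
  rewrite -(ge0_integral_normal_prob 0 r mF F0).
  rewrite (ge0_integral_normal_affine 0 (ltW r0) (lt0r_neq0 r0) cF F0).
  by apply: eq_integral => x _; rewrite add0r.
apply: eq_integral => z _.
have mhz : measurable_fun setT (fun x => h (x, z)).
  exact: measurableT_comp mh (measurable_fun_pair _ _).
rewrite ge0_integral_normal_prob//.
under eq_integral => x _ do
  rewrite /h/= -mulrA (normal_pdf_convol _ _ t0 r0 rE) mulrA EFinM.
rewrite ge0_integralZl//.
- by rewrite integral_normal_pdf mule1.
- by apply/measurable_EFinP; exact: measurable_normal_pdf.
- by move=> x _; rewrite lee_fin normal_pdf_ge0.
- by rewrite lee_fin mulr_ge0// normal_pdf_ge0.
Qed.

(** Splitting at 0 gives two half-line integrals, which the reflection exchanges. *)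
Lemma ge0_integral_lebesgue_oppr F : continuous F -> (forall x, 0 <= F x) ->
  (\int[mu]_x (F (- x)%R)%:E = \int[mu]_x (F x)%:E)%E.
Proof.
have split_half (G : R -> R) : continuous G -> (forall x, 0 <= G x) ->
    (\int[mu]_x (G x)%:E = \int[mu]_(x in `[0%R, +oo[) ((G \o -%R) x)%:E +
                           \int[mu]_(x in `[0%R, +oo[) (G x)%:E)%E.
  move=> cG G0; have mG := continuous_measurable_fun cG.
  rewrite -(setUv `[0%R, +oo[%classic) ge0_integral_setU//=; first last.
  - exact/disj_setPCl.
  - by move=> x _; rewrite lee_fin.
  - by apply/measurable_EFinP; rewrite setUv.
  - exact: measurableC.
  rewrite addeC; congr (_ + _)%E.
  rewrite setCitvr integral_itv_bndo_bndc; last first.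
    exact/measurable_EFinP/measurable_funTS.
  rewrite -{1}oppr0 ge0_integration_by_substitutionNy//.
  exact: continuous_subspaceT.
move=> cF F0.
rewrite [RHS]split_half// split_half//; last first.
  by move=> x; apply: continuous_comp; [exact: opp_continuous|exact: cF].
rewrite addeC; congr (_ + _)%E.
by apply: eq_integral => x _ /=; rewrite opprK.
Qed.

Lemma ge0_integral_normal_oppr F : continuous F -> (forall x, 0 <= F x) ->
  (\int[normal_prob 0 1]_x (F (- x)%R)%:E = \int[normal_prob 0 1]_x (F x)%:E)%E.
Proof.
move=> cF F0; have mF := continuous_measurable_fun cF.
have mFN : measurable_fun setT (fun x : R => F (- x)) by exact: measurableT_comp.
rewrite !ge0_integral_normal_prob// -[RHS]ge0_integral_lebesgue_oppr; first last.
- by move=> x; rewrite mulr_ge0// normal_pdf_ge0.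
- by move=> x; apply: cvgM; [exact: cF|exact: continuous_normal_pdf].
apply: eq_integral => x _; congr (_ * _)%:E.
by rewrite !normal_pdfE// /normal_fun !subr0 sqrrN.
Qed.

Lemma normal_prob_sqr_integrable :
  (normal_prob 0 1 : probability _ R).-integrable setT (fun x : R => (x ^+ 2)%:E).
Proof.
apply/integrableP; split; first exact/measurable_EFinP/measurable_funX.
under eq_integral do rewrite gee0_abs ?lee_fin ?sqr_ge0//.
rewrite (ge0_integral_normal_prob 0 1 (F := fun x => x ^+ 2)); last 2 first.
- exact: measurable_funX.
- by move=> x; rewrite sqr_ge0.
pose q : R := Num.sqrt 2.
have q2 : q ^+ 2 = 2 by rewrite sqr_sqrtr.
have q0 : 0 < q by rewrite sqrtr_gt0.
(* By 1 + u <= exp u at u = x^2 / 4, x^2 exp (- x^2 / 2) <= 4 exp (- x^2 / 4), a multiple of the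
   density of variance 2; the peaks in [C] adjust the normalizations. *)
pose C : R := 4 * normal_peak 1 / normal_peak q.
have sqrC x : x ^+ 2 * normal_pdf 0 1 x <= C * normal_pdf 0 q x.
  rewrite !normal_pdfE ?gt_eqF//.
  rewrite /C [leRHS]mulrA divfK ?gt_eqF ?normal_peak_gt0 ?gt_eqF//.
  rewrite mulrCA (mulrC 4) -[leRHS]mulrA ler_pM2l ?normal_peak_gt0 ?oner_neq0//.
  rewrite /normal_fun !subr0 q2 expr1n.
  have -> : - x ^+ 2 / (1 *+ 2) = - x ^+ 2 / (2 *+ 2) + - x ^+ 2 / (2 *+ 2).
    by field.
  rewrite expRD [leLHS]mulrA ler_wpM2r ?expR_ge0//.
  rewrite mulNr expRN ler_pdivrMr ?expR_gt0//.
  apply: (@le_trans _ _ (4 * (1 + x ^+ 2 / (2 *+ 2)))); first by lra.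
  by rewrite ler_pM2l// expR_ge1Dx.
apply: (@le_lt_trans _ _ (\int[mu]_x (C%:E * (normal_pdf 0 q x)%:E))%E).
  apply: ge0_le_integral => //.
  - by move=> x _; rewrite lee_fin mulr_ge0 ?sqr_ge0 ?normal_pdf_ge0.
  - apply/measurable_EFinP/measurable_funM; first exact: measurable_funX.
    exact: measurable_normal_pdf.
  - by apply/measurable_EFinP/measurable_funM => //; exact: measurable_normal_pdf.
  - by move=> x _; rewrite -EFinM lee_fin.
rewrite ge0_integralZl//.
- by rewrite integral_normal_pdf mule1 ltry.
- by apply/measurable_EFinP; exact: measurable_normal_pdf.
- by move=> x _; rewrite lee_fin normal_pdf_ge0.
- by rewrite lee_fin mulr_ge0// ?mulr_ge0 ?invr_ge0 ?normal_peak_ge0.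
Qed.

End normal_law.

Section bounded_integral.
Context d (T : measurableType d) (R : realType) (P : probability T R).
Implicit Types f g : T -> R.

Lemma bounded_integrable f (M : R) : measurable_fun setT f ->
  (forall x, `|f x| <= M) -> P.-integrable setT (EFin \o f).
Proof.
move=> mf fM.
have iM := finite_measure_integrable_cst P M measurableT : P.-integrable setT _.
apply: le_integrable iM => //.
- exact/measurable_EFinP.
- by move=> x _; rewrite /= lee_fin (le_trans (fM x))// ler_norm.
Qed.

Lemma integrable_cst (r : R) : P.-integrable setT (EFin \o (fun=> r)).
Proof. exact: (bounded_integrable (M := `|r|)). Qed.

Lemma integrableRD f g : P.-integrable setT (EFin \o f) ->
  P.-integrable setT (EFin \o g) ->
  P.-integrable setT (EFin \o (fun x => f x + g x)).
Proof. by move=> fi gi; have := integrableD measurableT fi gi. Qed.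

Lemma integrableRZ (r : R) f : P.-integrable setT (EFin \o f) ->
  P.-integrable setT (EFin \o (fun x => r * f x)).
Proof. by move=> fi; have := integrableZl measurableT r fi. Qed.

Lemma integrableRB f g : P.-integrable setT (EFin \o f) ->
  P.-integrable setT (EFin \o g) ->
  P.-integrable setT (EFin \o (fun x => f x - g x)).
Proof. by move=> fi gi; have := integrableB measurableT fi gi. Qed.

Lemma Rintegral_prob_cst (r : R) : \int[P]_x r = r.
Proof. by rewrite Rintegral_cst//= probability_setT mulr1. Qed.

End bounded_integral.

(** * Characteristic function of the standard normal law *)

Section gaussian_law.
Variable R : realType.
Local Notation gamma := (normal_prob 0 1 : probability _ R).
Implicit Types (m s t : R) (F : R -> R).

Lemma continuous_max0 F : continuous F -> continuous (fun x => Num.max (F x) 0).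
Proof. by move=> cF x; apply: continuous_max; [exact: cF|exact: cvg_cst]. Qed.

Lemma integral_normal_oppr F : continuous F ->
  \int[gamma]_x F (- x) = \int[gamma]_x F x.
Proof.
move=> cF; rewrite /Rintegral [in LHS]integralE [in RHS]integralE.
congr fine; congr (_ - _)%E.
- transitivity (\int[gamma]_x (Num.max (F (- x)) 0)%:E)%E.
    by apply: eq_integral => x _; rewrite funeposE EFin_max.
  rewrite (ge0_integral_normal_oppr (F := fun x => Num.max (F x) 0)).
  + by apply: eq_integral => x _; rewrite funeposE EFin_max.
  + exact: continuous_max0.
  + by move=> x; rewrite le_max lexx orbT.
- transitivity (\int[gamma]_x (Num.max (- F (- x)) 0)%:E)%E.
    by apply: eq_integral => x _; rewrite funenegE EFin_max.
  rewrite (ge0_integral_normal_oppr (F := fun x => Num.max (- F x) 0)).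
  + by apply: eq_integral => x _; rewrite funenegE EFin_max.
  + by apply: continuous_max0 => x; apply: cvgN; exact: cF.
  + by move=> x; rewrite le_max lexx orbT.
Qed.

Lemma normal_prob_id_integrable : gamma.-integrable setT (EFin \o (id : R -> R)).
Proof.
have i1 := integrableRD (integrable_cst gamma 1) (normal_prob_sqr_integrable R).
apply: le_integrable i1 => //; first exact/measurable_EFinP.
move=> x _ /=; rewrite lee_fin [leRHS]ger0_norm ?addr_ge0 ?sqr_ge0//.
rewrite -real_normK ?num_real//.
by nra.
Qed.

Lemma normal_prob_mean : \int[gamma]_x x = 0.
Proof.
have cid : continuous (id : R -> R) by move=> x; exact: cvg_id.
have /esym := integral_normal_oppr cid => /=.
under [in RHS]eq_Rintegral do rewrite -mulN1r.
rewrite RintegralZl//; last exact: normal_prob_id_integrable.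
by move=> e; lra.
Qed.

(** The value is 1, but positivity is enough to cancel it between second moments. *)
Definition normal_var : R := \int[gamma]_x (x ^+ 2).

Lemma normal_var_gt0 : 0 < normal_var.
Proof.
rewrite lt_def Rintegral_ge0 ?andbT; last by move=> x _; rewrite sqr_ge0.
apply/eqP => v0.
have : (\int[gamma]_x `|(x ^+ 2)%:E| = 0)%E.
  rewrite -[RHS]/(0%R%:E) -[in RHS]v0 /normal_var /Rintegral fineK.
    by apply: eq_integral => x _; rewrite gee0_abs// lee_fin sqr_ge0.
  exact: integrable_fin_num (normal_prob_sqr_integrable R).
move/ae_eq_integral_abs => [//||N [mN N0 sub]].
  exact/measurable_EFinP/measurable_funX.
(* A vanishing variance would put all the mass on {0}, which is Lebesgue null and so has none. *)
have : (gamma [set: R] <= gamma (N `|` [set (0%R : R)]))%E.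
  apply: le_measure; rewrite ?inE//; first exact: measurableU.
  move=> x _; have [->|x0] := eqVneq x 0; [by right|left].
  apply: sub => /= /(_ I)/eqP; rewrite eqe sqrf_eq0 => /eqP.
  by apply/eqP.
have g0 : (gamma [set (0%R : R)] = 0)%E.
  have /null_content_dominatesP := normal_prob_dominates (0 : R) 1.
  apply; [exact: measurable_set1 | exact: lebesgue_measure_set1].
have U2 : (gamma (N `|` [set (0%R : R)]) <= gamma N + gamma [set (0%R : R)])%E.
  exact: measureU2.
rewrite probability_setT => /le_trans/(_ U2).
by rewrite g0 [X in (X + _)%E]N0 adde0 leNgt lte01.
Qed.

Lemma measurable_cosM s : measurable_fun setT (fun x : R => cos (s * x)).
Proof.
apply: measurableT_comp; first exact: (continuous_measurable_fun (@continuous_cos R)).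
exact: measurable_funM.
Qed.

Lemma measurable_sinM s : measurable_fun setT (fun x : R => sin (s * x)).
Proof.
apply: measurableT_comp; first exact: (continuous_measurable_fun (@continuous_sin R)).
exact: measurable_funM.
Qed.

Lemma integrable_cosM s : gamma.-integrable setT (EFin \o (fun x : R => cos (s * x))).
Proof.
apply: (@bounded_integrable _ _ _ _ _ 1); first exact: measurable_cosM.
by move=> x; rewrite ler_norml cos_geN1 cos_le1.
Qed.

Lemma integrable_sinM s : gamma.-integrable setT (EFin \o (fun x : R => sin (s * x))).
Proof.
apply: (@bounded_integrable _ _ _ _ _ 1); first exact: measurable_sinM.
by move=> x; rewrite ler_norml sin_geN1 sin_le1.
Qed.

Lemma Rintegral_lin d (T : measurableType d) (P : probability T R)
    (r a b : R) (f g : T -> R) :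
  P.-integrable setT (EFin \o f) -> P.-integrable setT (EFin \o g) ->
  \int[P]_x (r + (a * f x + b * g x)) =
  r + (a * \int[P]_x f x + b * \int[P]_x g x).
Proof.
move=> fi gi; have afi := integrableRZ a fi; have bgi := integrableRZ b gi.
rewrite RintegralD//; [|exact: integrable_cst|exact: integrableRD].
by rewrite Rintegral_prob_cst RintegralD// !RintegralZl.
Qed.

Lemma integral_EFin_Rintegral d (T : measurableType d) (P : probability T R)
    (f : T -> R) : P.-integrable setT (EFin \o f) ->
  (\int[P]_x (f x)%:E)%E = (\int[P]_x f x)%:E.
Proof. by move=> fi; rewrite /Rintegral fineK//; exact: integrable_fin_num fi. Qed.

Lemma normal_sin s : \int[gamma]_x sin (s * x) = 0.
Proof.
have csin : continuous (fun x : R => sin (s * x)).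
  move=> x; apply: (@continuous_comp _ _ _ (fun x => s * x)).
    by apply: cvgM; [exact: cvg_cst|exact: cvg_id].
  exact: continuous_sin.
have := integral_normal_oppr csin.
under eq_Rintegral do rewrite mulrN sinN -mulN1r.
rewrite RintegralZl//; last exact: integrable_sinM.
by move=> e; lra.
Qed.

(** Multiplicativity of the characteristic function under convolution; by symmetry the sine part
    vanishes. [normal_convol] asks for a nonnegative integrand and positive scales, whence [1 + cos]
    and the separate cases s = 0 and t = 0. *)
Lemma normal_cosD s t (r : R) : 0 <= s -> 0 <= t -> 0 <= r ->
  r ^+ 2 = s ^+ 2 + t ^+ 2 ->
  \int[gamma]_x cos (r * x) =
    (\int[gamma]_x cos (s * x)) * (\int[gamma]_x cos (t * x)).
Proof.
have c0 : \int[gamma]_x cos (0 * x) = 1.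
  under eq_Rintegral do rewrite mul0r cos0.
  exact: Rintegral_prob_cst.
rewrite le_eqVlt => /predU1P[<- t0 r0|s0].
  rewrite expr0n add0r => /eqP; rewrite eqrXn2// => /eqP ->.
  by rewrite c0 mul1r.
rewrite le_eqVlt => /predU1P[<- r0|t0 r0' rE].
  rewrite expr0n addr0 => /eqP; rewrite eqrXn2 ?(ltW s0)// => /eqP ->.
  by rewrite c0 mulr1.
have r0 : 0 < r.
  by rewrite lt_def r0' andbT -sqrf_eq0 rE gt_eqF// addr_gt0 ?exprn_gt0.
have h0 (x : R) : 0 <= 1 + cos x by have := cos_geN1 x; lra.
have ch : continuous (fun x : R => 1 + cos x).
  by move=> x; apply: cvgD; [exact: cvg_cst|exact: continuous_cos].
have := normal_convol s0 t0 r0 rE ch h0.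
have lin_int (a b : R) (f g : R -> R) : gamma.-integrable setT (EFin \o f) ->
    gamma.-integrable setT (EFin \o g) ->
    (\int[gamma]_x (1 + (a * f x + b * g x))%:E =
     (1 + (a * \int[gamma]_x f x + b * \int[gamma]_x g x))%:E)%E.
  move=> fi gi; rewrite -Rintegral_lin//.
  apply: integral_EFin_Rintegral; apply: integrableRD; first exact: integrable_cst.
  by apply: integrableRD; exact: integrableRZ.
have -> : (\int[gamma]_x \int[gamma]_y (1 + cos (s * x + t * y))%:E)%E =
    (\int[gamma]_x (1 + (\int[gamma]_x cos (t * x) * cos (s * x) +
                         0 * cos (s * x)))%:E)%E.
  apply: eq_integral => x _.
  transitivity (\int[gamma]_y (1 + (cos (s * x) * cos (t * y) +
                                    (- sin (s * x)) * sin (t * y)))%:E)%E.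
    by apply: eq_integral => y _; rewrite cosD mulNr.
  rewrite lin_int; [|exact: integrable_cosM|exact: integrable_sinM].
  by rewrite normal_sin mulr0 mul0r mulrC.
rewrite lin_int; [|exact: integrable_cosM|exact: integrable_cosM].
have -> : (\int[gamma]_z (1 + cos (r * z))%:E)%E =
    (1 + (1 * \int[gamma]_z cos (r * z) + 0 * \int[gamma]_z cos (r * z)))%:E.
  rewrite -lin_int; [|exact: integrable_cosM|exact: integrable_cosM].
  by apply: eq_integral => z _; rewrite mul1r mul0r addr0.
by move=> [] /addrI; rewrite mul1r !mul0r !addr0 => <-; rewrite mulrC.
Qed.

End gaussian_law.

(** * Gaussian variables through the standard normal law *)

Section gaussian_rv_law.
Context (d : measure_display) (T : measurableType d) (R : realType).
Variable P : probability T R.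
Local Notation gamma := (normal_prob 0 1 : probability _ R).
Implicit Types (X Y : T -> R) (F : R -> R).

(** The point mass fits in as the scale 0, so degenerate and nondegenerate laws are treated alike
    from here on. *)
Lemma gaussian_rv_ge0_integral X : gaussian_rv P X ->
  exists m s : R, 0 <= s /\ forall F, continuous F -> (forall x, 0 <= F x) ->
    (\int[P]_t (F (X t))%:E = \int[gamma]_x (F (m + s * x)%R)%:E)%E.
Proof.
move=> [mX [m [s lawX]]]; exists m, `|s|; split => // F cF F0.
have mF := continuous_measurable_fun cF.
pose X' : T -> measurableTypeR R := X.
have mX' : measurable_fun [set: T] X' by exact: mX.
have -> : (\int[P]_t (F (X t))%:E = \int[pushforward P X']_x (F x)%:E)%E.
  rewrite ge0_integral_pushforward//; first exact/measurable_EFinP.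
  by move=> x _; rewrite lee_fin.
have [s0|s0] := eqVneq s 0.
  transitivity (\int[\d_(m : measurableTypeR R)]_x (F x)%:E)%E.
    apply: eq_measure_integral.
    by move=> A mA _; have := lawX A mA; rewrite s0 eqxx.
  rewrite integral_dirac//; last exact/measurable_EFinP.
  rewrite diracT mul1e s0 normr0.
  under eq_integral do rewrite mul0r addr0.
  rewrite (integral_EFin_Rintegral (integrable_cst gamma (F m))).
  by rewrite Rintegral_prob_cst.
transitivity (\int[normal_prob m s]_x (F x)%:E)%E.
  apply: eq_measure_integral.
  by move=> A mA _; have := lawX A mA; rewrite (negbTE s0).
rewrite ge0_integral_normal_prob// -normal_pdf_abs.
rewrite -(ge0_integral_normal_prob m `|s| mF F0).
by rewrite (ge0_integral_normal_affine m (normr_ge0 s) _ cF F0) ?normr_eq0.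
Qed.

Lemma gaussian_rv_integral X : gaussian_rv P X ->
  exists m s : R, 0 <= s /\ forall F, continuous F ->
    (\int[P]_t (F (X t))%:E = \int[gamma]_x (F (m + s * x)%R)%:E)%E /\
    (gamma.-integrable setT (EFin \o (fun x => F (m + s * x))) ->
     P.-integrable setT (EFin \o (fun t => F (X t)))).
Proof.
move=> gX; have [mX _] := gX.
have [m [s [s0 H]]] := gaussian_rv_ge0_integral gX.
exists m, s; split => // F cF; split.
  rewrite [LHS]integralE [RHS]integralE; congr (_ - _)%E.
  - transitivity (\int[P]_x (Num.max (F (X x)) 0)%:E)%E.
      by apply: eq_integral => x _; rewrite funeposE EFin_max.
    rewrite (H (fun x => Num.max (F x) 0)).
    + by apply: eq_integral => x _; rewrite funeposE EFin_max.
    + exact: continuous_max0.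
    + by move=> x; rewrite le_max lexx orbT.
  - transitivity (\int[P]_x (Num.max (- F (X x)) 0)%:E)%E.
      by apply: eq_integral => x _; rewrite funenegE EFin_max.
    rewrite (H (fun x => Num.max (- F x) 0)).
    + by apply: eq_integral => x _; rewrite funenegE EFin_max.
    + by apply: continuous_max0 => x; apply: cvgN; exact: cF.
    + by move=> x; rewrite le_max lexx orbT.
move=> /integrableP[_ fin]; apply/integrableP; split.
  apply/measurable_EFinP/measurableT_comp => //.
  exact: continuous_measurable_fun.
have := H (fun x => `|F x|).
rewrite /= => ->//; move=> x; apply: continuous_comp; [exact: cF|].
exact: norm_continuous.
Qed.

(** The mean forces m = 0, and then the second moment determines s >= 0, hence the whole law. *)
Lemma centered_gaussian_rv_integral X : gaussian_rv P X -> \int[P]_t X t = 0 ->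
  exists s : R, [/\ 0 <= s, s ^+ 2 * normal_var R = \int[P]_t (X t ^+ 2),
    P.-integrable setT (EFin \o X),
    P.-integrable setT (EFin \o (fun t => X t ^+ 2)) &
    forall F, continuous F -> \int[P]_t F (X t) = \int[gamma]_x F (s * x)].
Proof.
move=> gX EX; have [m [s [s0 H]]] := gaussian_rv_integral gX.
have cid : continuous (id : R -> R) by move=> x; exact: cvg_id.
have csq : continuous (fun x : R => x ^+ 2) by exact: sqr_continuous.
have ilin : gamma.-integrable setT (EFin \o (fun x : R => m + s * x)).
  apply: integrableRD; first exact: integrable_cst.
  exact/integrableRZ/normal_prob_id_integrable.
have m0 : m = 0.
  move: EX; rewrite /Rintegral (H _ cid).1 -/(Rintegral _ _ _).
  rewrite RintegralD//; last 2 first.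
  - exact: integrable_cst.
  - exact/integrableRZ/normal_prob_id_integrable.
  rewrite RintegralZl//; last exact: normal_prob_id_integrable.
  by rewrite normal_prob_mean mulr0 addr0 Rintegral_prob_cst.
have RH F : continuous F -> \int[P]_t F (X t) = \int[gamma]_x F (s * x).
  move=> cF; rewrite /Rintegral (H _ cF).1; congr fine.
  by apply: eq_integral => x _; rewrite m0 add0r.
have sqE : (fun x : R => (m + s * x) ^+ 2) = (fun x => s ^+ 2 * x ^+ 2).
  by apply/funext => x; rewrite m0 add0r exprMn.
exists s; split => //.
- rewrite (RH _ csq); under eq_Rintegral do rewrite exprMn.
  rewrite RintegralZl//; exact: normal_prob_sqr_integrable.
- exact: (H _ cid).2.
- apply: (H _ csq).2; rewrite sqE.
  exact/integrableRZ/normal_prob_sqr_integrable.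
Qed.

Lemma integrable_sqr_mul X Y : measurable_fun setT X -> measurable_fun setT Y ->
  P.-integrable setT (EFin \o (fun t => X t ^+ 2)) ->
  P.-integrable setT (EFin \o (fun t => Y t ^+ 2)) ->
  P.-integrable setT (EFin \o (fun t => X t * Y t)).
Proof.
move=> mX mY iX iY.
apply: le_integrable (integrableRD iX iY) => //.
  exact/measurable_EFinP/measurable_funM.
move=> t _ /=; rewrite lee_fin [leRHS]ger0_norm ?addr_ge0 ?sqr_ge0//.
by rewrite ler_norml; apply/andP; split; nra.
Qed.

Lemma integrable_cos X : measurable_fun setT X ->
  P.-integrable setT (EFin \o (fun t => cos (X t))).
Proof.
move=> mX; apply: (@bounded_integrable _ _ _ _ _ 1).
  exact: measurableT_comp (continuous_measurable_fun (@continuous_cos R)) mX.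
by move=> x; rewrite ler_norml cos_geN1 cos_le1.
Qed.

Lemma integrable_sin X : measurable_fun setT X ->
  P.-integrable setT (EFin \o (fun t => sin (X t))).
Proof.
move=> mX; apply: (@bounded_integrable _ _ _ _ _ 1).
  exact: measurableT_comp (continuous_measurable_fun (@continuous_sin R)) mX.
by move=> x; rewrite ler_norml sin_geN1 sin_le1.
Qed.

Lemma gaussian_uncorrelated_trig X Y :
  gaussian_rv P X -> gaussian_rv P Y ->
  gaussian_rv P (fun t => X t + Y t) -> gaussian_rv P (fun t => X t - Y t) ->
  \int[P]_t X t = 0 -> \int[P]_t Y t = 0 -> \int[P]_t (X t * Y t) = 0 ->
  [/\ \int[P]_t sin (X t) = 0, \int[P]_t sin (Y t) = 0,
      \int[P]_t (cos (X t) * cos (Y t)) = \int[P]_t cos (X t) * \int[P]_t cos (Y t),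
      \int[P]_t (sin (X t) * sin (Y t)) = 0 &
      \int[P]_t (cos (X t) * sin (Y t)) = 0 /\
      \int[P]_t (sin (X t) * cos (Y t)) = 0].
Proof.
move=> gX gY gD gB EX EY EXY.
have [s [s0 sE iX iX2 Xlaw]] := centered_gaussian_rv_integral gX EX.
have [t [t0 tE iY iY2 Ylaw]] := centered_gaussian_rv_integral gY EY.
have mX := gX.1; have mY := gY.1.
have iXY := integrable_sqr_mul mX mY iX2 iY2.
have ED : \int[P]_t (X t + Y t) = 0 by rewrite RintegralD// EX EY addr0.
have EB : \int[P]_t (X t - Y t) = 0 by rewrite RintegralB// EX EY subr0.
have [p [p0 pE _ _ Dlaw]] := centered_gaussian_rv_integral gD ED.
have [q [q0 qE _ _ Blaw]] := centered_gaussian_rv_integral gB EB.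
(* At a = 2 and a = - 2 the integrand is the square of the sum and of the difference. *)
have sqE (a : R) : \int[P]_t (X t ^+ 2 + (a * (X t * Y t) + 1 * Y t ^+ 2)) =
    \int[P]_t (X t ^+ 2) + \int[P]_t (Y t ^+ 2).
  rewrite RintegralD//; last exact: integrableRD (integrableRZ _ _) (integrableRZ _ _).
  rewrite RintegralD//; [|exact: integrableRZ|exact: integrableRZ].
  by rewrite !RintegralZl// EXY mulr0 add0r mul1r.
have v0 := normal_var_gt0 R.
have pst : p ^+ 2 = s ^+ 2 + t ^+ 2.
  apply: (mulIf (lt0r_neq0 v0)); rewrite mulrDl pE sE tE -(sqE 2).
  by apply: eq_Rintegral => u _; ring.
have qst : q ^+ 2 = s ^+ 2 + t ^+ 2.
  apply: (mulIf (lt0r_neq0 v0)); rewrite mulrDl qE sE tE -(sqE (- 2)).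
  by apply: eq_Rintegral => u _; ring.
have ccos := @continuous_cos R; have csin := @continuous_sin R.
have Dcos : \int[P]_t cos (X t + Y t) = \int[P]_t cos (X t) * \int[P]_t cos (Y t).
  by rewrite (Dlaw _ ccos) (Xlaw _ ccos) (Ylaw _ ccos); exact: normal_cosD.
have Bcos : \int[P]_t cos (X t - Y t) = \int[P]_t cos (X t) * \int[P]_t cos (Y t).
  by rewrite (Blaw _ ccos) (Xlaw _ ccos) (Ylaw _ ccos); exact: normal_cosD.
have Dsin : \int[P]_t sin (X t + Y t) = 0 by rewrite (Dlaw _ csin) normal_sin.
have Bsin : \int[P]_t sin (X t - Y t) = 0 by rewrite (Blaw _ csin) normal_sin.
have mD : measurable_fun setT (fun t => X t + Y t) by exact: measurable_funD.
have mB : measurable_fun setT (fun t => X t - Y t) by exact: measurable_funB.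
have lin (a b : R) f g : P.-integrable setT (EFin \o f) ->
    P.-integrable setT (EFin \o g) ->
    \int[P]_t (0 + (a * f t + b * g t)) = a * \int[P]_t f t + b * \int[P]_t g t.
  by move=> fi gi; rewrite Rintegral_lin// add0r.
split.
- by rewrite (Xlaw _ csin) normal_sin.
- by rewrite (Ylaw _ csin) normal_sin.
- transitivity (2^-1 * \int[P]_t cos (X t + Y t) + 2^-1 * \int[P]_t cos (X t - Y t)).
    rewrite -lin; [|exact: integrable_cos|exact: integrable_cos].
    by apply: eq_Rintegral => u _; rewrite cosB cosD; lra.
  by rewrite Dcos Bcos; lra.
- transitivity (- 2^-1 * \int[P]_t cos (X t + Y t) + 2^-1 * \int[P]_t cos (X t - Y t)).
    rewrite -lin; [|exact: integrable_cos|exact: integrable_cos].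
    by apply: eq_Rintegral => u _; rewrite cosB cosD; lra.
  by rewrite Dcos Bcos; lra.
- split.
  + transitivity (2^-1 * \int[P]_t sin (X t + Y t) + - 2^-1 * \int[P]_t sin (X t - Y t)).
      rewrite -lin; [|exact: integrable_sin|exact: integrable_sin].
      by apply: eq_Rintegral => u _; rewrite sinB sinD; lra.
    by rewrite Dsin Bsin; lra.
  + transitivity (2^-1 * \int[P]_t sin (X t + Y t) + 2^-1 * \int[P]_t sin (X t - Y t)).
      rewrite -lin; [|exact: integrable_sin|exact: integrable_sin].
      by apply: eq_Rintegral => u _; rewrite sinB sinD; lra.
    by rewrite Dsin Bsin; lra.
Qed.

End gaussian_rv_law.

(** * Bounded functionals annihilated by trigonometric functions *)

Section step_polynomials.
Variable R : realType.
Implicit Types (x v : R) (n : nat).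

Lemma cvg_exprn0 x : `|x| < 1 -> x ^+ n @[n --> \oo] --> 0.
Proof.
move=> x1; have := cvg_geometric 1 x1.
rewrite [X in X @ _](_ : _ = fun n => x ^+ n)//.
by apply/funext => n /=; rewrite mul1r.
Qed.

Lemma bernoulli_ge x n : -1 <= x -> 1 + n%:R * x <= (1 + x) ^+ n.
Proof.
move=> x1; elim: n => [|n IH]; first by rewrite mul0r addr0 expr0.
rewrite exprS (@le_trans _ _ ((1 + x) * (1 + n%:R * x)))//; last first.
  by rewrite ler_wpM2l//; lra.
by rewrite -natr1 mulrDl; have := ler0n R n; nra.
Qed.

(* The exponents are chosen so that [2 ^ (n * n + n) * v ^ (n * n)] tends to [0]
   for [v < 1/2] and to [+oo] for [v >= 1/2]. *)
Definition step_poly n v := (1 - v ^+ (n * n)) ^+ (2 ^ (n * n + n)).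

Lemma step_poly_range n v : 0 <= v <= 1 -> 0 <= step_poly n v <= 1.
Proof.
move=> /andP[v0 v1].
have /andP[w0 w1] : 0 <= 1 - v ^+ (n * n) <= 1.
  by rewrite subr_ge0 exprn_ile1//= gerBl exprn_ge0.
by rewrite /step_poly exprn_ge0//= exprn_ile1.
Qed.

(** Let w = v^(n n) and m = 2^(n n + n), so that m w = 2^n (2 v)^(n n). Bernoulli's inequality
    bounds (1 - w)^m from above by 1 / (1 + w)^m <= 1 / (1 + m w), where m w >= n if v >= 1/2, and
    from below by 1 - m w. *)
Lemma step_poly_cvg v : 0 <= v <= 1 ->
  step_poly n v @[n --> \oo] --> ((v < 2^-1)%R%:R : R).
Proof.
move=> /andP[v0 v1]; case: (ltP v 2^-1) => v2 /=; last first.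
  apply: (@squeeze_cvgr _ _ _ R (cst 0) (fun n => n.+1%:R^-1)); last 2 first.
  - exact: cvg_cst.
  - exact: cvg_harmonic.
  apply: nearW => n; have /andP[-> _]/= : 0 <= step_poly n v <= 1.
    by apply: step_poly_range; rewrite v0 v1.
  set w := v ^+ (n * n).
  have w0 : 0 <= w by rewrite exprn_ge0.
  have w1 : w <= 1 by rewrite exprn_ile1.
  have big : n.+1%:R <= (1 + w) ^+ (2 ^ (n * n + n)).
    apply: le_trans (bernoulli_ge _ _); last by lra.
    rewrite -natr1 addrC lerD2l.
    rewrite expnD natrM !natrX -mulrAC -exprMn.
    apply: (@le_trans _ _ (1 * 2 ^+ n)).
      by rewrite mul1r -natrX ler_nat ltnW// ltn_expl.
    rewrite ler_wpM2r ?exprn_ge0// exprn_ege1//.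
    lra.
  rewrite -[leRHS]mul1r ler_pdivlMr ?ltr0n//.
  apply: (@le_trans _ _ (step_poly n v * (1 + w) ^+ (2 ^ (n * n + n)))).
    by rewrite ler_wpM2l// exprn_ge0// subr_ge0.
  rewrite /step_poly -exprMn -/w exprn_ile1//.
    by rewrite mulr_ge0//; lra.
  by rewrite mulrDr mulr1 mulrBl mul1r; have := mulr_ge0 w0 w0; lra.
apply: (@squeeze_cvgr _ _ _ R (fun n => 1 - 2^-1 ^+ n) (cst 1)); last 2 first.
- rewrite -[X in _ --> X]subr0; apply: cvgB; first exact: cvg_cst.
  by apply: cvg_exprn0; rewrite ger0_norm//; lra.
- exact: cvg_cst.
have q1 : `|2 * v| < 1 by rewrite ger0_norm; lra.
(* Once (2 v)^n < 1/4, m w = (2 (2 v)^n)^n is at most 2^-n. *)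
have /cvgr_dist_lt/(_ (1/4)) := cvg_exprn0 q1.
move=> /(_ ltac:(lra)); apply: filterS => n.
rewrite sub0r normrN ger0_norm; last by rewrite exprn_ge0//; lra.
move=> qn; have /andP[_ ->] : 0 <= step_poly n v <= 1.
  by apply: step_poly_range; rewrite v0 v1.
rewrite andbT /step_poly.
apply: le_trans (bernoulli_ge _ _); last first.
  by rewrite lerN2 exprn_ile1.
rewrite mulrN lerD2l lerN2.
rewrite natrX exprD -mulrAC -exprMn exprM -exprMn.
by rewrite lerXn2r ?nnegrE ?mulr_ge0 ?exprn_ge0//; lra.
Qed.

End step_polynomials.

Section trig_uniqueness.
Context (d : measure_display) (T : measurableType d) (R : realType).
Variable P : probability T R.
Implicit Types (X f g H : T -> R) (A : set T).

Definition bounded_mfun f :=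
  measurable_fun setT f /\ exists M : R, forall t, `|f t| <= M.

Lemma bounded_mfun_cst (r : R) : bounded_mfun (fun=> r).
Proof. by split => //; exists `|r|. Qed.

Lemma bounded_mfunM f g : bounded_mfun f -> bounded_mfun g ->
  bounded_mfun (fun t => f t * g t).
Proof.
move=> [mf [M fM]] [mg [K gK]]; split; first exact: measurable_funM.
by exists (M * K) => t; rewrite normrM ler_pM.
Qed.

Lemma bounded_mfunD f g : bounded_mfun f -> bounded_mfun g ->
  bounded_mfun (fun t => f t + g t).
Proof.
move=> [mf [M fM]] [mg [K gK]]; split; first exact: measurable_funD.
by exists (M + K) => t; rewrite (le_trans (ler_normD _ _))// lerD.
Qed.

Lemma bounded_mfun_cos X : measurable_fun setT X -> bounded_mfun (fun t => cos (X t)).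
Proof.
move=> mX; split; last by exists 1 => t; rewrite ler_norml cos_geN1 cos_le1.
exact: measurableT_comp (continuous_measurable_fun (@continuous_cos R)) mX.
Qed.

Lemma bounded_mfun_sin X : measurable_fun setT X -> bounded_mfun (fun t => sin (X t)).
Proof.
move=> mX; split; last by exists 1 => t; rewrite ler_norml sin_geN1 sin_le1.
exact: measurableT_comp (continuous_measurable_fun (@continuous_sin R)) mX.
Qed.

Lemma bounded_mfun_indic A : measurable A -> bounded_mfun \1_A.
Proof.
move=> mA; split; first exact: measurable_indic.
by exists 1 => t; rewrite indicE; case: (t \in A); rewrite ?normr1 ?normr0.
Qed.

Lemma bounded_mfun_integrable f : bounded_mfun f -> P.-integrable setT (EFin \o f).
Proof. by move=> [mf [M fM]]; exact: bounded_integrable fM. Qed.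

Lemma bounded_cvg_Rintegral (f_ : nat -> T -> R) f (K : R) :
  (forall n, measurable_fun setT (f_ n)) -> measurable_fun setT f ->
  (forall n t, `|f_ n t| <= K) -> (forall t, f_ n t @[n --> \oo] --> f t) ->
  (forall n, \int[P]_t f_ n t = 0) -> \int[P]_t f t = 0.
Proof.
move=> mf_ mf f_K cf f0.
have if_ n : P.-integrable setT (EFin \o f_ n) by exact: bounded_integrable.
have [] := @dominated_convergence _ T R P setT measurableT
  (fun n => EFin \o f_ n) (EFin \o f) (EFin \o cst K).
- by move=> n; exact/measurable_EFinP.
- exact/measurable_EFinP.
- by apply: aeW => t _; apply/fine_cvgP; split; [exact: nearW|exact: cf].
- exact: integrable_cst.
- by apply: aeW => t n _; rewrite lee_fin.
move=> _ _; under eq_fun do rewrite integral_EFin_Rintegral// f0.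
by move=> /(cvg_unique _ (cvg_cst _)) e; rewrite /Rintegral -e.
Qed.

(* This condition is stable under multiplication of [f] by [sin (u X)], hence by
   polynomials in it, and these converge to the indicators of [sin (u X) < b]. *)
Definition trig_null X H f := bounded_mfun f /\ forall s,
  \int[P]_t (f t * cos (s * X t) * H t) = 0 /\
  \int[P]_t (f t * sin (s * X t) * H t) = 0.

Section one_variable.
Variables (X H : T -> R).
Hypotheses (mX : measurable_fun setT X) (bH : bounded_mfun H).

Let ib f : bounded_mfun f -> P.-integrable setT (EFin \o (fun t => f t * H t)).
Proof. by move=> bf; apply/bounded_mfun_integrable/bounded_mfunM. Qed.

Let bcos s : bounded_mfun (fun t => cos (s * X t)).
Proof. exact/bounded_mfun_cos/measurable_funM. Qed.

Let bsin s : bounded_mfun (fun t => sin (s * X t)).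
Proof. exact/bounded_mfun_sin/measurable_funM. Qed.

Lemma trig_null_lin (a b : R) f g : trig_null X H f -> trig_null X H g ->
  trig_null X H (fun t => a * f t + b * g t).
Proof.
move=> [bf f0] [bg g0]; split.
  by apply: bounded_mfunD; apply: bounded_mfunM => //; exact: bounded_mfun_cst.
move=> s; have [fc fs] := f0 s; have [gc gs] := g0 s.
have bfc := bounded_mfunM bf (bcos s); have bfs := bounded_mfunM bf (bsin s).
have bgc := bounded_mfunM bg (bcos s); have bgs := bounded_mfunM bg (bsin s).
split.
- transitivity (\int[P]_t (0 + (a * (f t * cos (s * X t) * H t) +
                                b * (g t * cos (s * X t) * H t)))).
    by apply: eq_Rintegral => t _; ring.
  by rewrite Rintegral_lin ?fc ?gc ?mulr0 ?addr0//; exact: ib.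
- transitivity (\int[P]_t (0 + (a * (f t * sin (s * X t) * H t) +
                                b * (g t * sin (s * X t) * H t)))).
    by apply: eq_Rintegral => t _; ring.
  by rewrite Rintegral_lin ?fs ?gs ?mulr0 ?addr0//; exact: ib.
Qed.

Lemma trig_null_sin f u : trig_null X H f -> trig_null X H (fun t => sin (u * X t) * f t).
Proof.
move=> [bf f0]; split; first exact: bounded_mfunM.
move=> s; have [pc ps] := f0 (u + s); have [mc ms] := f0 (u - s).
have bc r := bounded_mfunM bf (bcos r); have bs r := bounded_mfunM bf (bsin r).
split.
- transitivity (\int[P]_t (0 + (2^-1 * (f t * sin ((u + s) * X t) * H t) +
                                2^-1 * (f t * sin ((u - s) * X t) * H t)))).
    by apply: eq_Rintegral => t _; rewrite !mulrDl mulNr sinB sinD; field.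
  by rewrite Rintegral_lin ?ps ?ms ?mulr0 ?addr0//; exact: ib.
- transitivity (\int[P]_t (0 + (2^-1 * (f t * cos ((u - s) * X t) * H t) +
                                - 2^-1 * (f t * cos ((u + s) * X t) * H t)))).
    by apply: eq_Rintegral => t _; rewrite !mulrDl mulNr cosB cosD; field.
  by rewrite Rintegral_lin ?pc ?mc ?mulr0 ?addr0//; exact: ib.
Qed.

Lemma trig_null_step n u b f : trig_null X H f ->
  trig_null X H (fun t => step_poly n ((sin (u * X t) - b) / 4 + 2^-1) * f t).
Proof.
set v := fun t => (sin (u * X t) - b) / 4 + 2^-1.
have vnull g : trig_null X H g -> trig_null X H (fun t => v t * g t).
  move=> g0; have := trig_null_lin (4^-1) (- b / 4 + 2^-1) (trig_null_sin u g0) g0.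
  by congr trig_null; apply/funext => t; rewrite /v; field.
have vXnull k g : trig_null X H g -> trig_null X H (fun t => v t ^+ k * g t).
  elim: k g => [|k IH] g g0.
    by under eq_fun do rewrite expr0 mul1r.
  by under eq_fun do rewrite exprS -mulrA; apply/vnull/IH.
have wnull k g : trig_null X H g -> trig_null X H (fun t => (1 - v t ^+ k) * g t).
  move=> g0; have := trig_null_lin 1 (- 1) g0 (vXnull k _ g0).
  by congr trig_null; apply/funext => t; ring.
rewrite /step_poly; move: (2 ^ _)%N => m f0.
elim: m => [|m IH]; first by under eq_fun do rewrite expr0 mul1r.
by under eq_fun do rewrite exprS -mulrA; exact: wnull.
Qed.

Hypothesis HX : trig_null X H (cst 1).

Let null f : trig_null X H f -> \int[P]_t (f t * H t) = 0.
Proof.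
move=> [_ /(_ 0)[f0 _]]; rewrite -[RHS]f0; apply: eq_Rintegral => t _.
by rewrite mul0r cos0 mulr1.
Qed.

Let ltr_indic (f : T -> R) b t : \1_[set t | f t < b] t = (f t < b)%R%:R :> R.
Proof. by rewrite indicE; congr ((nat_of_bool _)%:R); apply/idP/idP; rewrite inE. Qed.

Let mlt f b : measurable_fun setT f -> measurable [set t | f t < b].
Proof.
move=> mf; rewrite -[X in measurable X]setTI.
by apply: (mf measurableT `]-oo, b[%classic); rewrite -?set_itvNyo//.
Qed.

Lemma trig_null_sin_lt u b : -1 <= b <= 1 ->
  \int[P]_t (\1_[set t | sin (u * X t) < b] t * H t) = 0.
Proof.
move=> /andP[b1 b2]; have [mH [M HM]] := bH.
(* Since sin and b differ by at most 2, division by 4 brings [v t] into [0, 1]; the threshold b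
   becomes 1/2. *)
pose v t := (sin (u * X t) - b) / 4 + 2^-1.
have v01 t : 0 <= v t <= 1.
  by have := sin_geN1 (u * X t); have := sin_le1 (u * X t); rewrite /v; lra.
have bs n := (trig_null_step n u b HX).1.
apply: (bounded_cvg_Rintegral (f_ := fun n t => step_poly n (v t) * 1 * H t) (K := M)).
- by move=> n; have [] := bounded_mfunM (bs n) bH.
- apply: measurable_funM => //; apply: measurable_indic; apply: mlt.
  by have [] := bsin u.
- move=> n t; have /andP[s0 s1] := step_poly_range n (v01 t).
  rewrite mulr1 normrM (ger0_norm s0).
  by apply: le_trans (HM t); rewrite ler_piMl.
- move=> t; apply: cvgM; last exact: cvg_cst.
  under eq_fun do rewrite mulr1.
  rewrite ltr_indic; have := step_poly_cvg (v01 t).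
  suff -> : (v t < 2^-1) = (sin (u * X t) < b) by [].
  by rewrite /v; apply/idP/idP; lra.
- by move=> n; exact: null (trig_null_step n u b HX).
Qed.

(** Sine is increasing near 0: once n >= |X t| + |b|, both arguments scaled by 1 / (n + 1) lie in
    [- 1, 1], and comparing their sines amounts to comparing [X t] with b. *)
Lemma trig_null_lt b : \int[P]_t (\1_[set t | X t < b] t * H t) = 0.
Proof.
have [mH [M HM]] := bH.
apply: (bounded_cvg_Rintegral (K := M)
  (f_ := fun n t => \1_[set t | sin (n.+1%:R^-1 * X t) < sin (n.+1%:R^-1 * b)] t * H t)).
- move=> n; apply: measurable_funM => //; apply: measurable_indic; apply: mlt.
  by have [] := bsin n.+1%:R^-1.
- by apply: measurable_funM => //; apply: measurable_indic; exact: mlt.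
- move=> n t; apply: le_trans (HM t); rewrite normrM ler_piMl// ltr_indic.
  by case: ltP; rewrite ?normr1 ?normr0.
- move=> t; apply: cvgM; last exact: cvg_cst.
  apply: cvg_near_cst.
  apply: filterS (nbhs_infty_ger (`|X t| + `|b|)) => n nK.
  rewrite !ltr_indic; congr (nat_of_bool _)%:R.
  have inpi (y : R) : `|y| <= n%:R -> n.+1%:R^-1 * y \in `[- (pi / 2), pi / 2].
    move=> yn; have p1 : 1 <= pi / 2 :> R by rewrite ler_pdivlMr// mul1r pi_ge2.
    have : `|n.+1%:R^-1 * y| <= 1.
      rewrite normrM normfV mulrC ler_pdivrMr ?normr_gt0// mul1r.
      by rewrite (le_trans yn)// ger0_norm// ler_nat.
    rewrite ler_norml in_itv/= => /andP[h1 h2].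
    by rewrite (le_trans _ h1) ?lerN2//= (le_trans h2).
  rewrite ltr_sin ?ltr_pM2l ?invr_gt0//; apply: inpi; apply: le_trans nK.
    by rewrite lerDl.
  by rewrite lerDr.
- by move=> n; apply: trig_null_sin_lt; rewrite sin_geN1 sin_le1.
Qed.

End one_variable.

Lemma integral_indicM A H : measurable A -> bounded_mfun H ->
  (\int[P]_(t in A) (H t)%:E = (\int[P]_t (\1_A t * H t))%:E)%E.
Proof.
move=> mA bH; rewrite -integral_EFin_Rintegral; last first.
  exact/bounded_mfun_integrable/bounded_mfunM/bH/bounded_mfun_indic.
rewrite integral_mkcond; apply: eq_integral => t _.
by rewrite epatch_indic/= -EFinM mulrC.
Qed.

(** The sets over which H integrates to 0 form a Dynkin system; the vanishing total integral gives
    stability under complement. *)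
Lemma null_g_sigma_algebra (G : set (set T)) H : setI_closed G ->
  G `<=` measurable -> P.-integrable setT (EFin \o H) ->
  (\int[P]_t (H t)%:E = 0)%E ->
  (forall A, G A -> (\int[P]_(t in A) (H t)%:E = 0)%E) ->
  forall A, <<s G >> A -> measurable A /\ (\int[P]_(t in A) (H t)%:E = 0)%E.
Proof.
move=> GI Gm iH HT GH A; rewrite -setI_closed_g_dynkin_g_sigma_algebra//.
pose D : set (set T) := [set A | measurable A /\ (\int[P]_(t in A) (H t)%:E = 0)%E].
move: A; suff : <<d G >> `<=` D by [].
apply: smallest_sub; last by move=> A GA; split; [exact: Gm|exact: GH].
split.
- by split.
- move=> A [mA A0]; have mAC := measurableC mA; split => //.
  move: HT; rewrite -(setUv A) integral_setU//.
  + by rewrite A0 add0e.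
  + by rewrite setUv; exact: measurable_int iH.
  + exact/disj_setPCl.
- move=> F tF DF; have mF n : measurable (F n) by have [] := DF n.
  split; first exact: bigcupT_measurable.
  rewrite integral_bigcup//; last first.
    by apply: integrableS iH => //; exact: bigcupT_measurable.
  by apply: eseries0 => n _ _; have [] := DF n.
Qed.

Lemma null_g_sigma_algebra_indic (G : set (set T)) H : setI_closed G ->
  G `<=` measurable -> bounded_mfun H -> \int[P]_t H t = 0 ->
  (forall A, G A -> \int[P]_t (\1_A t * H t) = 0) ->
  forall A, <<s G >> A -> measurable A /\ \int[P]_t (\1_A t * H t) = 0.
Proof.
move=> GI Gm bH H0 GH A sA.
have iH := bounded_mfun_integrable bH.
have [||mA] := null_g_sigma_algebra GI Gm iH _ _ sA.
- by rewrite integral_EFin_Rintegral// H0.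
- by move=> B GB; rewrite integral_indicM ?GH//; exact: Gm.
by rewrite integral_indicM// => -[].
Qed.

Lemma trig_null_preimage X H : measurable_fun setT X -> bounded_mfun H ->
  trig_null X H (cst 1) -> forall B, measurable B ->
  \int[P]_t (\1_(X @^-1` B) t * H t) = 0.
Proof.
move=> mX bH HX B mB.
have gB : <<s @RGenInftyO.G R >> B.
  by have := RGenInftyO.measurableE R; rewrite /measurable/= => <-; exact: mB.
have H0 : \int[P]_t H t = 0.
  have [+ _] := HX.2 0; under eq_Rintegral do rewrite mul0r cos0 !mul1r.
  by [].
pose G := preimage_set_system setT X (@RGenInftyO.G R).
have : <<s G >> (X @^-1` B).
  by rewrite g_sigma_preimageE; exists B => //; rewrite setTI.
have ltE b : setT `&` X @^-1` `]-oo, b[%classic = [set t | X t < b].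
  by apply/seteqP; split => t /=; rewrite in_itv/= ?andTb; tauto.
move=> /(@null_g_sigma_algebra_indic G H); case=> //.
- move=> _ _ [_ [a ->] <-] [_ [b ->] <-].
  exists `]-oo, (Num.min a b)[%classic; first by exists (Num.min a b).
  rewrite !ltE; apply/seteqP; split => t /=; rewrite lt_min.
    by move/andP.
  by move=> [-> ->].
- move=> _ [_ [a ->] <-]; apply: mX => //.
- by move=> _ [_ [a ->] <-]; rewrite ltE; exact: trig_null_lt.
Qed.

Definition sigma_of (V : set (T -> R)) : set (set T) :=
  <<s \bigcup_(v in V) preimage_set_system [set: T] v measurable >>.

Definition linear_space (V : set (T -> R)) :=
  [/\ V (fun=> 0), forall v, V v -> measurable_fun setT v &
      forall (a : R) u v, V u -> V v -> V (fun t => a * u t + v t)].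

(** A finite list of constraints v in B; with all v in V, these sets form a pi-system generating
    [sigma_of V]. *)
Let cylinder (l : seq ((T -> R) * set R)) : set T :=
  foldr (fun p A => p.1 @^-1` p.2 `&` A) setT l.

Let good (V : set (T -> R)) (l : seq ((T -> R) * set R)) :=
  foldr (fun p Q => (V p.1 /\ measurable p.2) /\ Q) True l.

Let cylinder_cat l1 l2 : cylinder (l1 ++ l2) = cylinder l1 `&` cylinder l2.
Proof.
by elim: l1 => [|p l1 IH]; rewrite /= ?setTI// IH setIA.
Qed.

Let measurable_cylinder V l : linear_space V -> good V l -> measurable (cylinder l).
Proof.
move=> [_ mV _]; elim: l => [|p l IH] //= [[Vp mp] gl].
apply: measurableI; last exact: IH.
by rewrite -[X in measurable X]setTI; exact: mV.
Qed.

(** The constraints are absorbed into H one at a time, so the induction is over all H. For a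
    constraint v in B and any u in V, the product formulas reduce cos (s v) cos u and its analogues
    to functions of s v + u and - s v + u, again in V; so [trig_null_preimage] applies to v with cos
    u H or sin u H in place of H. *)
Let trig_null_cylinder V l H : linear_space V -> bounded_mfun H ->
  (forall v, V v -> \int[P]_t (cos (v t) * H t) = 0 /\
                    \int[P]_t (sin (v t) * H t) = 0) ->
  good V l -> \int[P]_t (\1_(cylinder l) t * H t) = 0.
Proof.
move=> lV; have [V0 mV Vlin] := lV; elim: l H => [|[v B] l IH] H bH HV /=.
  have [+ _] := HV _ V0; rewrite indicT.
  by under eq_Rintegral do rewrite cos0.
move=> [[Vv mB] gl].
have mvB : measurable (v @^-1` B).
  by rewrite -[X in measurable X]setTI; exact: mV.
have indE t : \1_(v @^-1` B `&` cylinder l) t * H t =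
    \1_(cylinder l) t * (\1_(v @^-1` B) t * H t) by rewrite indicI/=; ring.
under eq_Rintegral do rewrite indE.
apply: (IH (fun t => \1_(v @^-1` B) t * H t)) gl.
  exact: bounded_mfunM (bounded_mfun_indic mvB) bH.
have bVcos u : V u -> bounded_mfun (fun t => cos (u t) * H t).
  by move=> Vu; apply: bounded_mfunM => //; exact/bounded_mfun_cos/mV.
have bVsin u : V u -> bounded_mfun (fun t => sin (u t) * H t).
  by move=> Vu; apply: bounded_mfunM => //; exact/bounded_mfun_sin/mV.
have lin (a b : R) f g : bounded_mfun f -> bounded_mfun g ->
    \int[P]_t f t = 0 -> \int[P]_t g t = 0 -> \int[P]_t (0 + (a * f t + b * g t)) = 0.
  move=> /bounded_mfun_integrable fi /bounded_mfun_integrable gi f0 g0.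
  by rewrite Rintegral_lin// f0 g0 !mulr0 !addr0.
move=> u Vu.
have VD s : V (fun t => s * v t + u t) by exact: Vlin.
have bc := bVcos _ (VD _); have bs := bVsin _ (VD _).
have Hcos s : \int[P]_t (1 * cos (s * v t) * (cos (u t) * H t)) = 0 /\
    \int[P]_t (1 * sin (s * v t) * (cos (u t) * H t)) = 0.
  have [Dc Ds] := HV _ (VD s); have [Bc Bs] := HV _ (VD (- s)).
  split.
  - rewrite -[RHS](lin 2^-1 2^-1 _ _ (bc s) (bc (- s)) Dc Bc).
    by apply: eq_Rintegral => t _; rewrite (mulNr s) !cosD cosN sinN; field.
  - rewrite -[RHS](lin 2^-1 (- 2^-1) _ _ (bs s) (bs (- s)) Ds Bs).
    by apply: eq_Rintegral => t _; rewrite (mulNr s) !sinD cosN sinN; field.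
have Hsin s : \int[P]_t (1 * cos (s * v t) * (sin (u t) * H t)) = 0 /\
    \int[P]_t (1 * sin (s * v t) * (sin (u t) * H t)) = 0.
  have [Dc Ds] := HV _ (VD s); have [Bc Bs] := HV _ (VD (- s)).
  split.
  - rewrite -[RHS](lin 2^-1 2^-1 _ _ (bs s) (bs (- s)) Ds Bs).
    by apply: eq_Rintegral => t _; rewrite (mulNr s) !sinD cosN sinN; field.
  - rewrite -[RHS](lin (- 2^-1) 2^-1 _ _ (bc s) (bc (- s)) Dc Bc).
    by apply: eq_Rintegral => t _; rewrite (mulNr s) !cosD cosN sinN; field.
have b1 := bounded_mfun_cst 1.
have := trig_null_preimage (mV _ Vv) (bVcos _ Vu) (conj b1 Hcos) mB.
have := trig_null_preimage (mV _ Vv) (bVsin _ Vu) (conj b1 Hsin) mB.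
by split; under eq_Rintegral do rewrite mulrCA.
Qed.

Lemma trig_null_sigma V H : linear_space V -> bounded_mfun H ->
  (forall v, V v -> \int[P]_t (cos (v t) * H t) = 0 /\
                    \int[P]_t (sin (v t) * H t) = 0) ->
  forall A, sigma_of V A -> measurable A /\ \int[P]_t (\1_A t * H t) = 0.
Proof.
move=> lV bH HV A sA.
pose G := [set cylinder l | l in good V].
have good_cat l1 l2 : good V l1 -> good V l2 -> good V (l1 ++ l2).
  by elim: l1 => [|p l1 IH] //= [? ?] ?; split => //; exact: IH.
apply: (@null_g_sigma_algebra_indic G) => //.
- move=> _ _ [l1 g1 <-] [l2 g2 <-]; exists (l1 ++ l2); first exact: good_cat.
  exact: cylinder_cat.
- by move=> _ [l gl <-]; exact: measurable_cylinder gl.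
- have [V0 _ _] := lV; have [+ _] := HV _ V0.
  by under eq_Rintegral do rewrite cos0 mul1r.
- by move=> _ [l gl <-]; exact: trig_null_cylinder gl.
move: A sA; apply: smallest_sub; first exact: smallest_sigma_algebra.
move=> _ [v Vv [B mB <-]]; apply: sub_sigma_algebra.
by exists [:: (v, B)]; rewrite /= ?setIT ?setTI.
Qed.

End trig_uniqueness.

(** * Orthogonal Gaussian spaces are independent *)

Section gaussian_independence.
Context (d : measure_display) (T : measurableType d) (R : realType).
Variable P : probability T R.
Implicit Types (f g H : T -> R) (A B : set T) (V : set (T -> R)).

Definition centered_gaussian_space V :=
  linear_space V /\ forall v, V v -> gaussian_rv P v /\ \int[P]_t v t = 0.

Lemma Rintegral_indic A : measurable A -> (\int[P]_t \1_A t)%:E = P A.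
Proof.
move=> mA; rewrite -integral_EFin_Rintegral; last first.
  exact/bounded_mfun_integrable/bounded_mfun_indic.
by rewrite integral_indic// setIT.
Qed.

Lemma sigma_of_measurable V : linear_space V -> sigma_of V `<=` measurable.
Proof.
move=> [_ mV _]; apply: smallest_sub; first exact: sigma_algebra_measurable.
by move=> _ [v Vv [B mB <-]]; exact: mV.
Qed.

(** Two passes. For fixed v in V2, the trigonometric functions of V1 annihilate sin v and cos v
    minus its mean, so the indicator of A factors from both. Then those of V2 annihilate the
    indicator of A minus its mean, and B can be inserted. *)
Lemma orthogonal_gaussian_independent V V1 V2 :
  centered_gaussian_space V -> linear_space V1 -> linear_space V2 ->
  V1 `<=` V -> V2 `<=` V ->
  (forall u v, V1 u -> V2 v -> \int[P]_t (u t * v t) = 0) ->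
  forall A B, sigma_of V1 A -> sigma_of V2 B -> P (A `&` B) = (P A * P B)%E.
Proof.
move=> [lV gV] lV1 lV2 V1V V2V orth A B sA sB.
have trig u v : V1 u -> V2 v -> _ := fun Vu Vv =>
  gaussian_uncorrelated_trig (gV _ (V1V _ Vu)).1 (gV _ (V2V _ Vv)).1.
have [_ mV Vlin] := lV.
have {}trig u v : V1 u -> V2 v ->
  [/\ \int[P]_t sin (u t) = 0, \int[P]_t sin (v t) = 0,
      \int[P]_t (cos (u t) * cos (v t)) = \int[P]_t cos (u t) * \int[P]_t cos (v t),
      \int[P]_t (sin (u t) * sin (v t)) = 0 &
      \int[P]_t (cos (u t) * sin (v t)) = 0 /\
      \int[P]_t (sin (u t) * cos (v t)) = 0].
  move=> Vu Vv; apply: trig => //.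
  - have := (gV _ (Vlin 1 _ _ (V1V _ Vu) (V2V _ Vv))).1.
    by under eq_fun do rewrite mul1r.
  - have := (gV _ (Vlin (- 1) _ _ (V2V _ Vv) (V1V _ Vu))).1.
    by under eq_fun do rewrite mulN1r addrC.
  - exact: (gV _ (V1V _ Vu)).2.
  - exact: (gV _ (V2V _ Vv)).2.
  - exact: orth.
have bcst := @bounded_mfun_cst _ T R.
have bcos v : V v -> bounded_mfun (fun t => cos (v t)).
  by move=> Vv; exact/bounded_mfun_cos/mV.
have bsin v : V v -> bounded_mfun (fun t => sin (v t)).
  by move=> Vv; exact/bounded_mfun_sin/mV.
(* centering a bounded function turns factorization into annihilation *)
have center f g : bounded_mfun f -> bounded_mfun g ->
    \int[P]_t (f t * (g t + - \int[P]_t g t)) =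
    \int[P]_t (f t * g t) - \int[P]_t f t * \int[P]_t g t.
  move=> bf bg; set c := \int[P]_t g t.
  transitivity (\int[P]_t (0 + (1 * (f t * g t) + - c * f t))).
    by apply: eq_Rintegral => t _; ring.
  rewrite Rintegral_lin; [ring| |]; apply: bounded_mfun_integrable => //.
  exact: bounded_mfunM.
have stepA v : V2 v ->
    \int[P]_t (\1_A t * cos (v t)) = \int[P]_t \1_A t * \int[P]_t cos (v t) /\
    \int[P]_t (\1_A t * sin (v t)) = 0.
  move=> Vv; have bcv := bcos _ (V2V _ Vv); have bsv := bsin _ (V2V _ Vv).
  split.
  - have bH := bounded_mfunD bcv (bcst (- \int[P]_t cos (v t))).
    have [|mA] := @trig_null_sigma _ T R P V1 _ lV1 bH _ A sA.
      move=> u Vu; have [su sv cc ss [cs sc]] := trig _ _ Vu Vv.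
      have bcu := bcos _ (V1V _ Vu); have bsu := bsin _ (V1V _ Vu).
      by rewrite !center// cc sc su mul0r !subrr.
    by rewrite center//; [move/eqP; rewrite subr_eq0 => /eqP|exact: bounded_mfun_indic].
  - have [|mA //] := @trig_null_sigma _ T R P V1 _ lV1 bsv _ A sA.
    move=> u Vu; have [su sv cc ss [cs sc]] := trig _ _ Vu Vv.
    by [].
have mA := sigma_of_measurable lV1 sA.
have b1A := bounded_mfun_indic R mA.
have bH := bounded_mfunD b1A (bcst (- \int[P]_t \1_A t)).
have [|mB] := @trig_null_sigma _ T R P V2 _ lV2 bH _ B sB.
  move=> v Vv; have bcv := bcos _ (V2V _ Vv); have bsv := bsin _ (V2V _ Vv).
  have [cA sA'] := stepA v Vv.
  rewrite !center//.
  under eq_Rintegral do rewrite mulrC.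
  rewrite cA [_ * \int[P]_t cos _]mulrC subrr.
  under eq_Rintegral do rewrite mulrC.
  rewrite sA' sub0r.
  have [V10 _ _] := lV1; have [_ -> _ _ _] := trig _ v V10 Vv.
  by rewrite mul0r oppr0.
rewrite center//; last exact: bounded_mfun_indic.
move/eqP; rewrite subr_eq0 => /eqP e.
rewrite -!Rintegral_indic//; last exact: measurableI.
rewrite -EFinM mulrC -e; congr EFin.
by apply: eq_Rintegral => t _; rewrite indicI/= mulrC.
Qed.

End gaussian_independence.

(** * Conditional probabilities *)

(* The measure [C |-> P (A `&` C)] on the sub-sigma-algebra generated by [S];
   the proof arguments only serve the inference of its measure structure. *)
Definition trace_measure (d : measure_display) (T : measurableType d)
    (R : realType) (P : probability T R) (S : set (set T)) (A : set T)
    (_ : <<s S >> `<=` measurable) (_ : measurable A) :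
    set (g_sigma_algebraType S) -> \bar R :=
  fun C => P (A `&` C).

Section trace_measure.
Context (d : measure_display) (T : measurableType d) (R : realType).
Variables (P : probability T R) (S : set (set T)) (A : set T).
Hypotheses (Sm : <<s S >> `<=` measurable) (mA : measurable A).
Local Notation trace := (trace_measure P Sm mA).

Let trace0 : trace set0 = 0%E.
Proof. by rewrite /trace_measure setI0 measure0. Qed.

Let trace_ge0 C : (0 <= trace C)%E.
Proof. exact: measure_ge0. Qed.

Let trace_sigma_additive : semi_sigma_additive trace.
Proof.
move=> F mF tF mUF; rewrite /trace_measure setI_bigcupr.
apply: measure_semi_sigma_additive.
- by move=> n; apply: measurableI => //; exact: Sm (mF n).
- exact: trivIset_setIl.
- by rewrite -setI_bigcupr; apply: measurableI => //; exact: Sm mUF.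
Qed.

HB.instance Definition _ := isMeasure.Build _ _ _ trace
  trace0 trace_ge0 trace_sigma_additive.

Let trace_fin : fin_num_fun trace.
Proof.
move=> C mC; rewrite /trace_measure fin_num_measure//.
by apply: measurableI => //; exact: Sm mC.
Qed.

HB.instance Definition _ := Measure_isFinite.Build _ _ _ trace trace_fin.

End trace_measure.

Section conditional_probability.
Context (d : measure_display) (T : measurableType d) (R : realType).
Variables (P : probability T R) (S : set (set T)).
Hypothesis Sm : <<s S >> `<=` measurable.
Implicit Types (f g h : T -> R) (A B C : set T).
Local Notation TS := (g_sigma_algebraType S).
Local Notation PS := (trace_measure P Sm measurableT).

Definition sub_measurable f := forall B : set R, measurable B -> <<s S >> (f @^-1` B).

Lemma sub_measurableP f : sub_measurable f <-> measurable_fun setT (f : TS -> R).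
Proof.
split=> [mf _ B mB|mf B mB]; first by rewrite setTI; exact: mf.
by have := mf measurableT _ mB; rewrite setTI.
Qed.

Lemma sub_measurable_measurable f : sub_measurable f -> measurable_fun setT f.
Proof. by move=> mf _ B mB; rewrite setTI; exact: Sm (mf _ mB). Qed.

Lemma ge0_integral_trace A (mA : measurable A) h :
  sub_measurable h -> (forall t, 0 <= h t) ->
  (\int[trace_measure P Sm mA]_t (h t)%:E = \int[P]_t (h t * \1_A t)%:E)%E.
Proof.
move=> mh h0.
(* The identity, seen as a measurable map onto the coarser structure, carries integrals from one
   measurable type to the other. *)
pose idS : T -> TS := id.
have mid : measurable_fun setT idS by move=> _ C mC; rewrite setTI; exact: Sm mC.
have mhS : measurable_fun setT (h : TS -> R) by exact/sub_measurableP.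
have PA : (P A < +oo)%E by rewrite ltey_eq fin_num_measure.
pose nu := mfrestr mA PA.
have -> : (\int[trace_measure P Sm mA]_t (h t)%:E =
           \int[pushforward nu idS]_t (h t)%:E)%E.
  apply: eq_measure_integral => C mC _.
  by rewrite /pushforward /= /mfrestr /mrestr /trace_measure setIC.
rewrite ge0_integral_pushforward//=; last 2 first.
- exact/measurable_EFinP.
- by move=> t _; rewrite lee_fin.
apply: ge0_integral_density => //.
- exact/bounded_mfun_integrable/bounded_mfun_indic.
- by move=> C mC; rewrite integral_indic// /nu /= /mfrestr /mrestr setIC.
- exact: sub_measurable_measurable.
Qed.

Lemma ge0_integral_trace_setT h :
  sub_measurable h -> (forall t, 0 <= h t) ->
  (\int[PS]_t (h t)%:E = \int[P]_t (h t)%:E)%E.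
Proof.
move=> mh h0; rewrite ge0_integral_trace//.
by apply: eq_integral => t _; rewrite indicT mulr1.
Qed.

Lemma sub_measurable_indic C : <<s S >> C -> sub_measurable \1_C.
Proof. by move=> sC; apply/sub_measurableP; exact: (measurable_indic (T := TS)). Qed.

Lemma sub_measurableM f g : sub_measurable f -> sub_measurable g ->
  sub_measurable (fun t => f t * g t).
Proof.
by move=> /sub_measurableP mf /sub_measurableP mg; apply/sub_measurableP/measurable_funM.
Qed.

Lemma sub_measurable_funpos f : sub_measurable f ->
  sub_measurable (fun t => Num.max (f t) 0).
Proof.
by move=> /sub_measurableP mf; apply/sub_measurableP/measurable_maxr.
Qed.

Lemma sub_measurableN f : sub_measurable f -> sub_measurable (fun t => - f t).
Proof.
by move=> /sub_measurableP mf; apply/sub_measurableP/measurableT_comp.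
Qed.

Lemma sub_integrableP f : sub_measurable f -> P.-integrable setT (EFin \o f) ->
  PS.-integrable setT (EFin \o f).
Proof.
move=> mf /integrableP[_ fi]; apply/integrableP; split.
  exact/measurable_EFinP/sub_measurableP.
rewrite (_ : (\int[_]_x _)%E = \int[P]_t (`|f t|)%:E)%E//.
rewrite -ge0_integral_trace_setT//.
by apply/sub_measurableP/measurableT_comp => //; exact/sub_measurableP.
Qed.

Lemma integral_trace_setT f : sub_measurable f ->
  (\int[PS]_t (f t)%:E = \int[P]_t (f t)%:E)%E.
Proof.
move=> mf; rewrite [LHS]integralE [RHS]integralE; congr (_ - _)%E.
- transitivity (\int[PS]_x (Num.max (f x) 0)%:E)%E.
    by apply: eq_integral => x _; rewrite funeposE EFin_max.
  rewrite ge0_integral_trace_setT.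
  + by apply: eq_integral => x _; rewrite funeposE EFin_max.
  + exact: sub_measurable_funpos.
  + by move=> x; rewrite le_max lexx orbT.
- transitivity (\int[PS]_x (Num.max (- f x) 0)%:E)%E.
    by apply: eq_integral => x _; rewrite funenegE EFin_max.
  rewrite ge0_integral_trace_setT.
  + by apply: eq_integral => x _; rewrite funenegE EFin_max.
  + exact: (sub_measurable_funpos (sub_measurableN mf)).
  + by move=> x; rewrite le_max lexx orbT.
Qed.

Lemma integral_trace f C : sub_measurable f -> <<s S >> C ->
  (\int[PS]_(t in C) (f t)%:E = \int[P]_(t in C) (f t)%:E)%E.
Proof.
move=> mf sC; rewrite [LHS]integral_mkcond [RHS]integral_mkcond.
rewrite !epatch_indic; apply: integral_trace_setT (fun t => f t * \1_C t) _.
exact: sub_measurableM (sub_measurable_indic sC).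
Qed.

(** This is the Radon-Nikodym derivative of the trace of A with respect to the restriction of P. The
    nonnegative version lets the integrals below be handled without integrability conditions. *)
Lemma cond_prob_exists A : measurable A ->
  exists f, (forall t, 0 <= f t) /\ is_cond_prob P <<s S >> A f.
Proof.
move=> mA.
have dom : trace_measure P Sm mA `<< PS.
  apply/null_content_dominatesP => C mC C0.
  have {}C0 : P C = 0%E by rewrite -[RHS]C0 /= /trace_measure setTI.
  change (P (A `&` C) = 0%E).
  apply/eqP; rewrite -measure_le0 -C0 /=; apply: le_measure; rewrite ?inE.
  - by apply: measurableI => //; exact: Sm mC.
  - exact: Sm mC.
  - exact: subIsetr.
pose F := @Radon_Nikodym_SigmaFinite.f _ TS R (trace_measure P Sm mA) PS.
pose f t := fine (F t).
have FE t : (f t)%:E = F t.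
  by rewrite fineK//; exact: Radon_Nikodym_SigmaFinite.f_fin_num.
have FEE : EFin \o f = F by apply/funext.
have iF : PS.-integrable setT (EFin \o f).
  by rewrite FEE; exact: Radon_Nikodym_SigmaFinite.f_integrable.
have mf : sub_measurable f.
  by apply/sub_measurableP/measurable_EFinP; exact: measurable_int iF.
have f0 t : 0 <= f t by rewrite fine_ge0// Radon_Nikodym_SigmaFinite.f_ge0.
exists f; split => //; split => //.
- apply/integrableP; split.
    exact/measurable_EFinP/sub_measurable_measurable.
  under eq_integral do rewrite /= ger0_norm//.
  rewrite -ge0_integral_trace_setT//.
  move/integrableP : iF => [_]; under eq_integral do rewrite /= ger0_norm//.
  by [].
- move=> C sC; rewrite -integral_trace//.
  under eq_integral do rewrite FE.
  by rewrite -Radon_Nikodym_SigmaFinite.f_integral.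
Qed.

Lemma cond_prob_unique A f g : is_cond_prob P <<s S >> A f ->
  is_cond_prob P <<s S >> A g -> {ae P, forall t, f t = g t}.
Proof.
move=> [mf fi fA] [mg gi gA].
have : ae_eq PS setT (EFin \o f) (EFin \o g).
  apply: integral_ae_eq => //.
  - exact: sub_integrableP.
  - exact/measurable_EFinP/sub_measurableP.
  - by move=> C _ sC; rewrite !integral_trace// fA// gA.
move=> [N [mN N0 sub]]; exists N; split => //.
- exact: Sm mN.
- by rewrite -N0 /= /trace_measure setTI.
- by move=> t tN; apply: sub => /= /(_ I) [].
Qed.

(** On the sub-sigma-algebra, [g] is the density of the trace of A with respect to P. *)
Lemma cond_prob_pull_out A g h : measurable A -> is_cond_prob P <<s S >> A g ->
  sub_measurable h -> (forall t, 0 <= h t) ->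
  (\int[P]_t (h t * g t)%:E = \int[P]_t (h t * \1_A t)%:E)%E.
Proof.
move=> mA [mg gi gA] mh h0.
rewrite -(ge0_integral_trace mA mh h0).
rewrite -(integral_trace_setT (sub_measurableM mh mg)).
apply/esym; apply: ge0_integral_density => //.
- exact: sub_integrableP.
- by move=> C sC; rewrite integral_trace// gA.
- exact/sub_measurableP.
Qed.

Lemma integral_indicE C f :
  (\int[P]_(t in C) (f t)%:E = \int[P]_t (f t * \1_C t)%:E)%E.
Proof. by rewrite integral_mkcond epatch_indic. Qed.

(** In the one-sided form, f is also a version of P(A | F2, G). Pulling out f times the indicator of
    C exchanges P(B | G) with the indicator of B, which is the passage between the two forms. *)
Lemma cond_indepP (F1 F2 : set (set T)) :
  F1 `<=` measurable -> F2 `<=` measurable ->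
  cond_indep P F1 F2 <<s S >> <->
  forall A, F1 A -> exists f, [/\ forall t, 0 <= f t, is_cond_prob P <<s S >> A f &
    forall B C, F2 B -> <<s S >> C ->
      (\int[P]_(t in B `&` C) (f t)%:E = P (A `&` (B `&` C)))%E].
Proof.
move=> F1m F2m; split=> [ci A FA|H A B FA FB].
  have [f [f0 fA]] := cond_prob_exists (F1m _ FA).
  exists f; split => // B C FB sC.
  (* [f'] carries no sign, so the pull-out is done with the nonnegative version [f], equal to it
     almost everywhere. *)
  have [f' [g [f'A gB [mfg fgi fgAB]]]] := ci A B FA FB.
  have [mf fi _] := fA; have [mf' _ _] := f'A; have [mg _ _] := gB.
  have mC := sub_measurable_indic sC.
  rewrite integral_indicE.
  transitivity (\int[P]_t ((f t * \1_C t) * \1_B t)%:E)%E.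
    by apply: eq_integral => t _; rewrite indicI/=; congr EFin; ring.
  rewrite -(cond_prob_pull_out (F2m _ FB) gB (sub_measurableM mf mC)); last first.
    by move=> t; rewrite mulr_ge0// indicE.
  rewrite setIA -fgAB// integral_indicE.
  apply: ae_eq_integral => //.
  - apply/measurable_EFinP/sub_measurable_measurable.
    exact: sub_measurableM (sub_measurableM mf mC) mg.
  - apply/measurable_EFinP/sub_measurable_measurable.
    exact: sub_measurableM (sub_measurableM mf' mg) mC.
  - have := cond_prob_unique fA f'A; apply: filterS => t fE _ /=.
    by rewrite fE; congr EFin; ring.
have [f [f0 fA fAB]] := H A FA.
have [g [g0 gB]] := cond_prob_exists (F2m _ FB).
have [mf fi _] := fA; have [mg _ _] := gB.
exists f, g; split => //.
have fgE C : <<s S >> C -> (\int[P]_(t in C) (f t * g t)%:E = P (A `&` B `&` C))%E.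
  move=> sC; have mC := sub_measurable_indic sC.
  rewrite integral_indicE -setIA -fAB// integral_indicE.
  transitivity (\int[P]_t ((f t * \1_C t) * g t)%:E)%E.
    by apply: eq_integral => t _; congr EFin; ring.
  rewrite (cond_prob_pull_out (F2m _ FB) gB (sub_measurableM mf mC)); last first.
    by move=> t; rewrite mulr_ge0// indicE.
  by apply: eq_integral => t _; rewrite indicI/=; congr EFin; ring.
split => //; first exact: sub_measurableM.
apply/integrableP; split.
  exact/measurable_EFinP/(sub_measurable_measurable (sub_measurableM mf mg)).
under eq_integral do rewrite /= ger0_norm ?mulr_ge0//.
have sT : <<s S >> setT by move=> G' [[G0 GC _] _]; rewrite -setC0 -setTD; exact: GC.
rewrite fgE// setIT ltey_eq fin_num_measure//.
by apply: measurableI; [exact: F1m|exact: F2m].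
Qed.

End conditional_probability.

(** * Conditional independence in Gaussian spaces *)

Section independent_product.
Context (d : measure_display) (T : measurableType d) (R : realType).
Variable P : probability T R.
Implicit Types (X Y : T -> R).

(** By independence the joint law of X and Y is the product of their laws, and Fubini's theorem
    separates the integral. *)
Lemma independent_Rintegral_mul X Y :
  P.-integrable setT (EFin \o X) -> P.-integrable setT (EFin \o Y) ->
  P.-integrable setT (EFin \o (fun t => X t * Y t)) ->
  (forall D E : set R, measurable D -> measurable E ->
    P (X @^-1` D `&` Y @^-1` E) = (P (X @^-1` D) * P (Y @^-1` E))%E) ->
  \int[P]_t (X t * Y t) = \int[P]_t X t * \int[P]_t Y t.
Proof.
move=> iX iY iXY ind.
have mX : measurable_fun setT X by apply/measurable_EFinP; exact: measurable_int iX.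
have mY : measurable_fun setT Y by apply/measurable_EFinP; exact: measurable_int iY.
pose X' : {mfun T >-> R} := mfun_Sub (mem_set mX).
pose Y' : {mfun T >-> R} := mfun_Sub (mem_set mY).
have mXY : measurable_fun setT (fun t => (X' t, Y' t) : (R * R)%type).
  exact: measurable_fun_pair.
pose m1 := distribution P X'; pose m2 := distribution P Y'.
have prodE : forall Z, measurable Z ->
    (m1 \x m2)%E Z = pushforward P (fun t => (X' t, Y' t)) Z.
  by apply: product_measure_unique => D E mD mE; exact: ind.
have mmul : measurable_fun setT (fun z : R * R => (z.1 * z.2)%:E).
  by apply/measurable_EFinP/measurable_funM.
have prod_push (f : R * R -> \bar R) : (\int[(m1 \x m2)%E]_z f z =
    \int[pushforward P (fun t => (X' t, Y' t))]_z f z)%E.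
  by apply: eq_measure_integral => Z mZ _; exact: prodE.
have iprod : (m1 \x m2)%E.-integrable setT (fun z : R * R => (z.1 * z.2)%:E).
  apply/integrableP; split => //; rewrite prod_push ge0_integral_pushforward//=.
    by have /integrableP[] := iXY.
  apply/measurable_EFinP/measurableT_comp => //.
  exact: measurable_funM.
have EX : (\int[m1]_x x%:E = (\int[P]_t X t)%:E)%E.
  rewrite integral_distribution//; first exact: integral_EFin_Rintegral.
have EY : (\int[m2]_x x%:E = (\int[P]_t Y t)%:E)%E.
  rewrite integral_distribution//; first exact: integral_EFin_Rintegral.
have mid : measurable_fun setT (EFin \o (id : R -> R)) by exact/measurable_EFinP.
have im1 : m1.-integrable setT (EFin \o (id : R -> R)).
  exact: (integrable_pushforward mX mid iX measurableT).
have im2 : m2.-integrable setT (EFin \o (id : R -> R)).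
  exact: (integrable_pushforward mY mid iY measurableT).
suff : (\int[P]_t (X t * Y t)%:E = (\int[P]_t X t * \int[P]_t Y t)%:E)%E.
  by rewrite integral_EFin_Rintegral// => -[].
transitivity (\int[(m1 \x m2)%E]_z (z.1 * z.2)%:E)%E.
  by rewrite prod_push integral_pushforward.
rewrite -integral12_prod_meas1// /fubini_F/=.
transitivity (\int[m1]_x (x%:E * (\int[P]_t Y t)%:E))%E.
  by apply: eq_integral => x _; rewrite -EY -integralZl.
by rewrite integralZr// EX EFinM.
Qed.

End independent_product.

Section gaussian_conditional_independence.
Context (d : measure_display) (T : measurableType d) (R : realType).
Variable P : probability T R.
Implicit Types (V W : set (T -> R)).

Definition sum_space V W : set (T -> R) :=
  [set v | exists b g, [/\ V b, W g & v = (fun t => b t + g t)]].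

Lemma sum_spacel V W : linear_space W -> V `<=` sum_space V W.
Proof.
move=> [W0 _ _] v Vv; exists v, (fun=> 0); split => //.
by apply/funext => t; rewrite addr0.
Qed.

Lemma sum_spacer V W : linear_space V -> W `<=` sum_space V W.
Proof.
move=> [V0 _ _] v Vv; exists (fun=> 0), v; split => //.
by apply/funext => t; rewrite add0r.
Qed.

Lemma sum_space_linear V W : linear_space V -> linear_space W ->
  linear_space (sum_space V W).
Proof.
move=> lV lW; have [V0 mV Vlin] := lV; have [W0 mW Wlin] := lW; split.
- exact: (sum_spacel lW).
- by move=> _ [b [g [/mV mb /mW mg ->]]]; exact: measurable_funD.
- move=> a _ _ [b [g [Vb Wg ->]]] [b' [g' [Vb' Wg' ->]]].
  exists (fun t => a * b t + b' t), (fun t => a * g t + g' t).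
  by split; [exact: Vlin|exact: Wlin|apply/funext => t; ring].
Qed.

Lemma sum_space_sub U V W : linear_space U -> V `<=` U -> W `<=` U ->
  sum_space V W `<=` U.
Proof.
move=> [_ _ Ulin] VU WU _ [b [g [Vb Wg ->]]].
by have := Ulin 1 _ _ (VU _ Vb) (WU _ Wg); under eq_fun do rewrite mul1r.
Qed.

Lemma sigma_of_sigma_algebra V : sigma_algebra setT (sigma_of V).
Proof. exact: smallest_sigma_algebra. Qed.

Lemma sigma_ofT V : sigma_of V setT.
Proof.
by have [G0 GC _] := sigma_of_sigma_algebra V; rewrite -setC0 -setTD; exact: GC.
Qed.

Lemma sigma_ofI V A B : sigma_of V A -> sigma_of V B -> sigma_of V (A `&` B).
Proof.
exact: (@measurableI _ (g_sigma_algebraType (\bigcup_(v in V)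
  preimage_set_system [set: T] v measurable))).
Qed.

Lemma sigma_of_preimage V v (D : set R) : V v -> measurable D ->
  sigma_of V (v @^-1` D).
Proof.
by move=> Vv mD; apply: sub_sigma_algebra; exists v => //; exists D; rewrite ?setTI.
Qed.

Lemma sigma_of_sub V W : V `<=` W -> sigma_of V `<=` sigma_of W.
Proof.
move=> VW; apply: smallest_sub; first exact: sigma_of_sigma_algebra.
by move=> _ [v /VW Wv [D mD <-]]; rewrite setTI; exact: sigma_of_preimage.
Qed.

Definition rectangles V W : set (set T) :=
  [set E | exists B C, [/\ sigma_of V B, sigma_of W C & E = B `&` C]].

Lemma rectanglesI V W : setI_closed (rectangles V W).
Proof.
move=> _ _ [B [C [sB sC ->]]] [B' [C' [sB' sC' ->]]].
exists (B `&` B'), (C `&` C'); split; [exact: sigma_ofI|exact: sigma_ofI|].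
by rewrite setIACA.
Qed.

Lemma sigma_of_sum_space V W : sigma_of (sum_space V W) `<=` <<s rectangles V W >>.
Proof.
apply: smallest_sub; first exact: smallest_sigma_algebra.
move=> _ [_ [b [g [Vb Wg ->]]] [D mD <-]].
pose TR := g_sigma_algebraType (rectangles V W).
have mb : measurable_fun setT (b : TR -> R).
  move=> _ E mE; rewrite setTI; apply: sub_sigma_algebra.
  exists (b @^-1` E), setT; rewrite setIT; split => //; last exact: sigma_ofT.
  exact: sigma_of_preimage.
have mg : measurable_fun setT (g : TR -> R).
  move=> _ E mE; rewrite setTI; apply: sub_sigma_algebra.
  exists setT, (g @^-1` E); rewrite setTI; split => //; first exact: sigma_ofT.
  exact: sigma_of_preimage.
exact: (measurable_funD mb mg).
Qed.

Lemma cond_prob_independent (S : set (set T)) A : <<s S >> `<=` measurable ->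
  measurable A -> (forall C, <<s S >> C -> P (A `&` C) = (P A * P C)%E) ->
  is_cond_prob P <<s S >> A (fun=> fine (P A)).
Proof.
move=> Sm mA ind; split.
- by apply/sub_measurableP.
- exact: integrable_cst.
- move=> C sC; rewrite integral_cst//; last exact: Sm sC.
  by rewrite fineK ?fin_num_measure// ind.
Qed.

Lemma rectangles_measurable V W : linear_space V -> linear_space W ->
  rectangles V W `<=` measurable.
Proof.
move=> lV lW _ [B [C [sB sC ->]]].
by apply: measurableI; [exact: sigma_of_measurable sB|exact: sigma_of_measurable sC].
Qed.

(** [f] minus the indicator of A integrates to 0 over the rectangles, a pi-system whose
    sigma-algebra contains [sigma_of (sum_space V W)]. *)
Lemma integral_rectangles V W A f : linear_space V -> linear_space W ->
  measurable A -> P.-integrable setT (EFin \o f) ->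
  (forall B C, sigma_of V B -> sigma_of W C ->
    (\int[P]_(t in B `&` C) (f t)%:E = P (A `&` (B `&` C)))%E) ->
  forall E, sigma_of (sum_space V W) E ->
    (\int[P]_(t in E) (f t)%:E = P (A `&` E))%E.
Proof.
move=> lV lW mA fi fBC E sE.
have i1A : P.-integrable setT (EFin \o \1_A).
  exact/bounded_mfun_integrable/bounded_mfun_indic.
have diffE B : measurable B -> (\int[P]_(t in B) (f t - \1_A t)%:E =
    \int[P]_(t in B) (f t)%:E - P (A `&` B))%E.
  move=> mB; rewrite -integral_indic//.
  by rewrite -integralB_EFin//; apply: integrableS measurableT mB _ _ => //.
have finB B : measurable B -> P (A `&` B) \is a fin_num.
  by move=> mB; rewrite fin_num_measure//; exact: measurableI.
have mR := rectangles_measurable lV lW.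
have [|||mE] := @null_g_sigma_algebra _ T R P (rectangles V W)
  (fun t => f t - \1_A t) (@rectanglesI V W) mR _ _ _ E (sigma_of_sum_space sE).
- exact: integrableRB.
- have sV : sigma_of V setT by exact: sigma_ofT.
  have sW : sigma_of W setT by exact: sigma_ofT.
  rewrite diffE//; have := fBC _ _ sV sW.
  by rewrite !setIT => ->; rewrite subee// fin_num_measure.
- move=> _ [B [C [sB sC ->]]].
  have mBC : measurable (B `&` C) by apply: mR; exists B, C.
  by rewrite diffE// fBC// subee// finB.
rewrite diffE// => /eqP; rewrite sube_eq ?finB//; last first.
  by apply: integrable_fin_num => //; apply: integrableS measurableT _ _ fi.
by rewrite add0e => /eqP.
Qed.

Section orthogonality.
Variables V VA VB VG : set (T -> R).
Hypotheses (gV : centered_gaussian_space P V).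
Hypotheses (lA : linear_space VA) (lB : linear_space VB) (lG : linear_space VG).
Hypotheses (AV : VA `<=` V) (BV : VB `<=` V) (GV : VG `<=` V).

(** An element b + g of the sum that is orthogonal to VG is the residual of b, with projection - g;
    so residuals are described without a projection map. *)
Definition residual_orthogonal := forall v, sum_space VB VG v ->
  (forall g, VG g -> \int[P]_t (v t * g t) = 0) ->
  forall a, VA a -> \int[P]_t (v t * a t) = 0.

Let BGV : sum_space VB VG `<=` V.
Proof. by apply: sum_space_sub => //; exact: gV.1. Qed.

Let AGV : sum_space VA VG `<=` V.
Proof. by apply: sum_space_sub => //; exact: gV.1. Qed.

Let mA := sigma_of_measurable lA.
Let mB := sigma_of_measurable lB.
Let mG := sigma_of_measurable lG.

(** Let f be the probability of (a in E) given VG. Conditional independence gives P(a in E, v in D)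
    as the integral of f over (v in D); v is orthogonal to VG, hence independent of f, and the
    integral factors. So v and a are independent and the mean of v a is 0. *)
Lemma cond_indep_residual :
  cond_indep P (sigma_of VA) (sigma_of VB) (sigma_of VG) -> residual_orthogonal.
Proof.
move=> /(cond_indepP P mG mA mB) ci v BGv vG a Aa.
have Vv := BGV BGv; have Va := AV Aa.
have [gv Ev] := gV.2 _ Vv; have [ga Ea] := gV.2 _ Va.
have [s1 [_ _ iv iv2 _]] := centered_gaussian_rv_integral gv Ev.
have [s2 [_ _ ia ia2 _]] := centered_gaussian_rv_integral ga Ea.
have iva := integrable_sqr_mul gv.1 ga.1 iv2 ia2.
rewrite (independent_Rintegral_mul iv ia iva) ?Ev ?mul0r// => D E mD mE.
(* The line through v, a linear space orthogonal to [VG]. *)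
pose Vv1 : set (T -> R) := [set w | exists s : R, w = (fun t => s * v t)].
have lv1 : linear_space Vv1.
  split.
  - by exists 0; apply/funext => t; rewrite mul0r.
  - by move=> _ [s ->]; apply: measurable_funM => //; exact: gv.1.
  - move=> x _ _ [s ->] [s' ->]; exists (x * s + s').
    by apply/funext => t; rewrite mulrDl mulrA.
have v1V : Vv1 `<=` V.
  move=> _ [s ->]; have [V0 _ Vlin] := gV.1.
  by have := Vlin s _ _ Vv V0; under eq_fun do rewrite addr0.
have sD : sigma_of Vv1 (v @^-1` D).
  apply: sigma_of_preimage mD; exists 1.
  by apply/funext => t; rewrite mul1r.
have indG C : sigma_of VG C -> P (v @^-1` D `&` C) = (P (v @^-1` D) * P C)%E.
  apply: (orthogonal_gaussian_independent gV lv1 lG v1V GV) sD => _ g [s ->] Gg.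
  under eq_Rintegral do rewrite -mulrA.
  rewrite RintegralZl ?vG ?mulr0//.
  have [gg Eg] := gV.2 _ (GV Gg).
  have [s3 [_ _ _ ig2 _]] := centered_gaussian_rv_integral gg Eg.
  exact: integrable_sqr_mul gv.1 gg.1 iv2 ig2.
have mvD : measurable (v @^-1` D) by exact: sigma_of_measurable sD.
have sE : sigma_of VA (a @^-1` E) by exact: sigma_of_preimage.
have [f [f0 fA fBC]] := ci _ sE.
have [mf fi fC] := fA.
have sBG : sigma_of (sum_space VB VG) (v @^-1` D) by exact: sigma_of_preimage.
have := integral_rectangles lB lG (mA sE) fi fBC sBG.
rewrite integral_indicE.
rewrite -(cond_prob_pull_out mG mvD (cond_prob_independent mG mvD indG) mf f0).
under eq_integral do rewrite mulrC EFinM.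
rewrite integralZl// fineK ?fin_num_measure//.
by rewrite fC ?setIT; [rewrite setIC|exact: sigma_ofT].
Qed.

(** The space [VB'] of residuals is orthogonal to VG and, by hypothesis, to VA; so it is independent
    of VA and VG jointly, and f has the right integral over rectangles of [VB'] and VG. The
    projections put VB inside the sum of these two spaces. *)
Lemma residual_cond_indep :
  (forall b, VB b -> exists g, VG g /\
    forall g', VG g' -> \int[P]_t ((b t - g t) * g' t) = 0) ->
  residual_orthogonal ->
  cond_indep P (sigma_of VA) (sigma_of VB) (sigma_of VG).
Proof.
move=> proj res; apply/(cond_indepP P mG mA mB) => A sA.
have [f [f0 fA]] := cond_prob_exists P mG (mA sA).
exists f; split => // B C sB sC; have [mf fi fC] := fA.
pose VB' : set (T -> R) := [set v | sum_space VB VG v /\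
  forall g, VG g -> \int[P]_t (v t * g t) = 0].
have lBG := sum_space_linear lB lG.
have int2 u w : V u -> V w -> P.-integrable setT (EFin \o (fun t => u t * w t)).
  move=> Vu Vw; have [gu Eu] := gV.2 _ Vu; have [gw Ew] := gV.2 _ Vw.
  have [s1 [_ _ _ iu2 _]] := centered_gaussian_rv_integral gu Eu.
  have [s2 [_ _ _ iw2 _]] := centered_gaussian_rv_integral gw Ew.
  exact: integrable_sqr_mul gu.1 gw.1 iu2 iw2.
have lB' : linear_space VB'.
  have [BG0 BGm BGlin] := lBG; split.
  - split=> // g Gg; under eq_Rintegral do rewrite mul0r.
    exact: Rintegral_prob_cst.
  - by move=> v [/BGm].
  - move=> x u w [BGu u0] [BGw w0]; split; first exact: BGlin.
    move=> g Gg.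
    transitivity (\int[P]_t (0 + (x * (u t * g t) + 1 * (w t * g t)))).
      by apply: eq_Rintegral => t _; ring.
    rewrite Rintegral_lin ?u0 ?w0 ?mulr0 ?addr0//; apply: int2;
      by [exact: BGV|exact: GV].
have B'V : VB' `<=` V by move=> v [/BGV].
have lAG := sum_space_linear lA lG.
have rect B' C' : sigma_of VB' B' -> sigma_of VG C' ->
    (\int[P]_(t in B' `&` C') (f t)%:E = P (A `&` (B' `&` C')))%E.
  move=> sB' sC'; have mB' := sigma_of_measurable lB' sB'.
  have indG C1 : sigma_of VG C1 -> P (B' `&` C1) = (P B' * P C1)%E.
    apply: (orthogonal_gaussian_independent gV lB' lG B'V GV) sB' => u g [_ u0].
    exact: u0.
  have indAG : P (B' `&` (A `&` C')) = (P B' * P (A `&` C'))%E.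
    apply: (orthogonal_gaussian_independent gV lB' lAG B'V AGV) sB' _.
    - move=> u _ [BGu u0] [a [g [Aa Gg ->]]].
      transitivity (\int[P]_t (0 + (1 * (u t * a t) + 1 * (u t * g t)))).
        by apply: eq_Rintegral => t _; ring.
      have Vu := BGV BGu.
      rewrite Rintegral_lin; [|exact: int2 (AV Aa)|exact: int2 (GV Gg)].
      by rewrite (res _ BGu u0 _ Aa) (u0 _ Gg) !mulr0 !addr0.
    - apply: sigma_ofI; first exact: sigma_of_sub (sum_spacel lG) _ sA.
      exact: sigma_of_sub (sum_spacer lA) _ sC'.
  rewrite setICA indAG -fC//.
  rewrite integral_indicE.
  transitivity (\int[P]_t ((f t * \1_C' t) * \1_B' t)%:E)%E.
    by apply: eq_integral => t _; rewrite indicI/=; congr EFin; ring.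
  have mC' := @sub_measurable_indic _ _ R _ _ sC'.
  rewrite -(cond_prob_pull_out mG mB' (cond_prob_independent mG mB' indG)
    (sub_measurableM mf mC')); last by move=> t; rewrite mulr_ge0// indicE.
  under eq_integral do rewrite mulrC EFinM.
  rewrite integralZl//; last first.
    apply: le_integrable fi => //.
      exact/measurable_EFinP/(sub_measurable_measurable mG (sub_measurableM mf mC')).
    move=> t _; rewrite /= lee_fin normrM ler_piMr// indicE.
    by case: (t \in C'); rewrite ?normr1 ?normr0.
  by rewrite fineK ?fin_num_measure// [in RHS]integral_indicE.
apply: (integral_rectangles lB' lG (mA sA) fi rect).
apply: sigma_ofI.
- apply: sigma_of_sub sB => b Bb; have [g [Gg gb]] := proj _ Bb.
  exists (fun t => b t - g t), g; split => //; last by apply/funext => t; rewrite subrK.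
  split => //; have [_ _ BGlin] := lBG.
  have := BGlin (- 1) _ _ (sum_spacer lB Gg) (sum_spacel lG Bb).
  by congr sum_space; apply/funext => t; ring.
- apply: sigma_of_sub sC; exact: sum_spacer.
Qed.

End orthogonality.
End gaussian_conditional_independence.

(** * Orthogonality of residuals for a semidefinite form *)

Section semidefinite_form.
Variables (R : realFieldType) (n : nat) (S : 'M[R]_n).
Hypothesis symS : S^T = S.
Hypothesis psdS : forall w : 'rV[R]_n, 0 <= (w *m S *m w^T) 0 0.

Lemma form_sym p q (A : 'M[R]_(p, n)) (B : 'M[R]_(q, n)) :
  A *m S *m B^T = (B *m S *m A^T)^T.
Proof. by rewrite !trmx_mul trmxK symS mulmxA. Qed.

(** For isotropic w the form at s w + e is affine in s, and it stays nonnegative only if the slope,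
    twice the pairing of w with e, is 0. *)
Lemma psd_null_row (w : 'rV[R]_n) : w *m S *m w^T = 0 -> w *m S = 0.
Proof.
move=> w0; apply/rowP => i; rewrite [RHS]mxE.
set b := (w *m S) 0 i; pose e : 'rV[R]_n := delta_mx 0 i.
have we : w *m S *m e^T = b%:M.
  by rewrite trmx_delta -colE [LHS]mx11_scalar mxE.
have ew : e *m S *m w^T = b%:M by rewrite form_sym we tr_scalar_mx.
set q := (e *m S *m e^T) 0 0.
have quad s : 0 <= 2 * s * b + q.
  have := psdS (s *: w + e).
  rewrite !mulmxDl linearD/= linearZ/= !mulmxDr -!scalemxAr -!scalemxAl w0 we ew.
  rewrite /q; move: (e *m S *m e^T) => qm.
  by rewrite !mxE eqxx !mulr1n; lra.
apply/eqP; apply: contraT => b0.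
(* At this s the affine function takes the value - 1. *)
have := quad (- (q + 1) / (2 * b)).
suff -> : 2 * (- (q + 1) / (2 * b)) * b = - (q + 1) by lra.
by field.
Qed.

Lemma psd_null p (A : 'M[R]_(p, n)) : A *m S *m A^T = 0 -> A *m S = 0.
Proof.
move=> A0; apply/row_matrixP => i; rewrite row_mul row0.
apply: psd_null_row; rewrite rowE trmx_mul.
set u := delta_mx 0 i; have -> : u *m A *m S *m (A^T *m u^T) = u *m (A *m S *m A^T) *m u^T.
  by rewrite !mulmxA.
by rewrite A0 mulmx0 mul0mx.
Qed.

(** The Gram matrix of M may be singular. If it kills K, then K^T M is null for the form and so
    orthogonal to B; hence the rows of B S M^T lie in the row space of the Gram matrix. *)
Lemma form_projection p q (M : 'M[R]_(p, n)) (B : 'M[R]_(q, n)) :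
  exists D : 'M[R]_(q, p), (B - D *m M) *m S *m M^T = 0.
Proof.
have MK r (K : 'M[R]_(p, r)) : M *m S *m M^T *m K = 0 -> B *m S *m M^T *m K = 0.
  move=> MK0; have : K^T *m M *m S = 0.
    apply: psd_null; rewrite trmx_mul trmxK !mulmxA.
    by rewrite -!mulmxA (mulmxA M) (mulmxA (M *m S)) MK0 mulmx0.
  move=> KM; have -> : B *m S *m M^T *m K = B *m (K^T *m M *m S)^T.
    by rewrite !trmx_mul trmxK symS !mulmxA.
  by rewrite KM trmx0 mulmx0.
have : (B *m S *m M^T <= M *m S *m M^T)%MS.
  by rewrite submxE; apply/eqP/MK; exact: mulmx_coker.
move/submxP => [D DE]; exists D.
by rewrite !mulmxBl DE !mulmxA subrr.
Qed.

Section span.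
Variables (N d : nat) (X : nat -> 'M[R]_(d, n)).
Implicit Types (J A B G : pred nat).

(** Square generators give the spans of all index sets one common matrix type. *)
Definition span_mx J : 'M[R]_n := (\sum_(k < N.+1 | J k) <<X k>>)%MS.

Lemma sub_span_mx J k : (k <= N)%N -> J k -> (X k <= span_mx J)%MS.
Proof.
move=> kN Jk; rewrite -ltnS in kN.
by apply: (sumsmx_sup (Ordinal kN)) => //; rewrite genmxE.
Qed.

Lemma span_mxP p J (w : 'M[R]_(p, n)) : (w <= span_mx J)%MS ->
  exists D : nat -> 'M[R]_(p, d), w = \sum_(k < N.+1 | J k) D k *m X k.
Proof.
move=> /sub_sumsmxP[D ->].
have sub (k : 'I_N.+1) : exists E : 'M[R]_(p, d), D k *m <<X k>>%MS = E *m X k.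
  by apply/submxP; rewrite (submx_trans (submxMl _ _))// genmxE.
have [E EE] := choice sub.
exists (fun k => E (inord k)); apply: eq_bigr => k _.
by rewrite EE inord_val.
Qed.

Lemma orth_span p q J (z : 'M[R]_(p, n)) (u : 'M[R]_(q, n)) :
  (forall k, (k <= N)%N -> J k -> z *m S *m (X k)^T = 0) ->
  (u <= span_mx J)%MS -> z *m S *m u^T = 0.
Proof.
move=> zX /span_mxP[D ->]; rewrite linear_sum mulmx_sumr big1// => k Jk.
by rewrite /= trmx_mul mulmxA zX ?mul0mx// -ltnS.
Qed.

Lemma orth_addsmx p q (A B : 'M[R]_n) (z : 'M[R]_(p, n)) (u : 'M[R]_(q, n)) :
  z *m S *m A^T = 0 -> z *m S *m B^T = 0 -> (u <= A + B)%MS -> z *m S *m u^T = 0.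
Proof.
move=> zA zB /sub_addsmxP[[D E] ->] /=.
by rewrite linearD/= !trmx_mul mulmxDr !mulmxA zA zB !mul0mx addr0.
Qed.

Definition residual_orth A B G := forall v : 'rV[R]_n,
  (v <= span_mx B + span_mx G)%MS -> v *m S *m (span_mx G)^T = 0 ->
  v *m S *m (span_mx A)^T = 0.

Lemma residual_orthM p A B G (v : 'M[R]_(p, n)) : residual_orth A B G ->
  (v <= span_mx B + span_mx G)%MS -> v *m S *m (span_mx G)^T = 0 ->
  v *m S *m (span_mx A)^T = 0.
Proof.
move=> res vBG vG; apply/row_matrixP => i; rewrite !row_mul row0; apply: res.
  exact: submx_trans (row_sub _ _) vBG.
by rewrite -!row_mul vG row0.
Qed.

(** The residual of the span of B is orthogonal to A and G, hence to v; as v is orthogonal to G, it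
    is orthogonal to the projection removed from B, and so to B itself. *)
Lemma residual_orthC A B G : residual_orth A B G -> residual_orth B A G.
Proof.
move=> res v vAG vG; have [D DE] := form_projection (span_mx G) (span_mx B).
have BG : (span_mx B - D *m span_mx G <= span_mx B + span_mx G)%MS.
  rewrite addmx_sub ?eqmx_opp ?addsmxSl//.
  exact: submx_trans (submxMl _ _) (addsmxSr _ _).
have := residual_orthM res BG DE => BA.
have : (span_mx B - D *m span_mx G) *m S *m v^T = 0 by exact: orth_addsmx BA DE vAG.
rewrite !mulmxBl -!mulmxA (mulmxA (span_mx G)) form_sym vG trmx0 mulmx0 subr0.
by rewrite mulmxA => Bv; rewrite mulmxA form_sym Bv trmx0.
Qed.

Section dual.
Variable Xh : nat -> 'M[R]_(d, n).

Definition dual_at k := forall j, (j <= N)%N ->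
  Xh k *m S *m (X j)^T = if k == j then 1%:M else 0.

Lemma dual_orth_span k J p (u : 'M[R]_(p, n)) : dual_at k -> ~~ J k ->
  (u <= span_mx J)%MS -> Xh k *m S *m u^T = 0.
Proof.
move=> Xk nJk; apply: orth_span => j jN Jj; rewrite Xk//.
by case: eqP nJk => // ->; rewrite Jj.
Qed.

(* The combination [w] of the duals that agrees with [v] on the span of [A] lies in the
   span of [A] and [G]; there [v] and [w] induce the same form, and [v] is orthogonal
   to [w], so that [w] is null. *)
Lemma residual_orth_dual A B G :
  (forall k, (k <= N)%N -> A k -> [/\ dual_at k, ~~ B k & ~~ G k]) ->
  (forall k, (k <= N)%N -> A k -> (Xh k <= span_mx A + span_mx G)%MS) ->
  residual_orth A B G.
Proof.
move=> dA subA v vBG vG.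
pose w : 'rV[R]_n := \sum_(k < N.+1 | A k) v *m S *m (X k)^T *m Xh k.
have wAG : (w <= span_mx A + span_mx G)%MS.
  apply: summx_sub => k Ak; rewrite (submx_trans (submxMl _ _))//.
  by apply: subA => //; rewrite -ltnS.
have wX j : (j <= N)%N -> w *m S *m (X j)^T = if A j then v *m S *m (X j)^T else 0.
  move=> jN; rewrite !mulmx_suml.
  have term (k : 'I_N.+1) : A k -> v *m S *m (X k)^T *m Xh k *m S *m (X j)^T =
      if k == j :> nat then v *m S *m (X k)^T else 0.
    move=> Ak; have [dk _ _] := dA _ (leq_ord k) Ak.
    rewrite -(mulmxA _ _ S) -(mulmxA _ _ (X j)^T) dk//.
    by case: eqP => _; rewrite ?mulmx1 ?mulmx0.
  rewrite (eq_bigr _ term); case: ifPn => [Aj|nAj].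
    rewrite -ltnS in jN; rewrite (bigD1 (Ordinal jN))//= eqxx big1 ?addr0//.
    by move=> k /andP[_]; rewrite -val_eqE/= => /negbTE ->.
  by apply: big1 => k Ak; case: eqP Ak nAj => // -> ->.
have vw_orth q (u : 'M[R]_(q, n)) : (u <= span_mx A + span_mx G)%MS ->
    (v - w) *m S *m u^T = 0.
  apply: orth_addsmx.
  - apply: (orth_span _ (submx_refl _)) => k kN Ak.
    by rewrite !mulmxBl wX// Ak subrr.
  - apply: (orth_span _ (submx_refl _)) => k kN Gk.
    rewrite !mulmxBl wX//; case: ifPn => [Ak|_].
      by have [_ _] := dA _ kN Ak; rewrite Gk.
    have /submxP[D ->] := sub_span_mx kN Gk.
    by rewrite trmx_mul mulmxA vG mul0mx subrr.
have vw : v *m S *m w^T = 0.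
  rewrite linear_sum mulmx_sumr big1// => k Ak /=.
  have [dk Bk Gk] := dA _ (leq_ord k) Ak.
  suff vX : v *m S *m (Xh k)^T = 0 by rewrite trmx_mul mulmxA vX mul0mx.
  have dB := dual_orth_span dk Bk (submx_refl _).
  have dG := dual_orth_span dk Gk (submx_refl _).
  by rewrite form_sym (orth_addsmx dB dG vBG) trmx0.
have ww : w *m S *m w^T = 0.
  have := vw_orth _ w wAG; rewrite !mulmxBl vw sub0r => /eqP.
  by rewrite oppr_eq0 => /eqP.
have wS := psd_null_row ww.
have := vw_orth _ (span_mx A) (addsmxSl _ _).
by rewrite !mulmxBl wS mul0mx subr0.
Qed.

(* Subtract from [X c] its projection on the span of [G]: up to the factor [lam], the
   residual is orthogonal to the span of [A], hence to itself. *)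
Lemma residual_orth_coef A B G k c (lam : 'M[R]_d) (u : 'M[R]_(d, n)) :
  (k <= N)%N -> (c <= N)%N -> A k -> B c -> ~~ B k -> ~~ G k ->
  dual_at k -> (forall j, (j <= N)%N -> G j -> [/\ dual_at j & j != c]) ->
  X c *m S *m (X c)^T \in unitmx ->
  (u <= span_mx A + span_mx G)%MS -> Xh k = u + lam *m X c ->
  residual_orth A B G -> lam = 0.
Proof.
move=> kN cN Ak Bc nBk nGk dk dG Xc_unit uAG XhE res.
have [D DE] := form_projection (span_mx G) (X c).
pose h := D *m span_mx G; pose v := lam *m (X c - h).
have hG : (h <= span_mx G)%MS by exact: submxMl.
have vG : v *m S *m (span_mx G)^T = 0.
  by rewrite /v -!mulmxA (mulmxA (X c - h)) DE mulmx0.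
have vBG : (v <= span_mx B + span_mx G)%MS.
  rewrite (submx_trans (submxMl _ _))// addmx_sub ?eqmx_opp//.
    exact: submx_trans (sub_span_mx cN Bc) (addsmxSl _ _).
  exact: submx_trans hG (addsmxSr _ _).
have vA := residual_orthM res vBG vG.
(* [v] lies in the spans of B and G, to which [Xh k] is orthogonal; [v] is also orthogonal to [u],
   which leaves the term in [X c]. *)
have Xcv : lam *m X c *m S *m v^T = 0.
  have : Xh k *m S *m v^T = 0.
    have dB := dual_orth_span dk nBk (submx_refl _).
    have dG' := dual_orth_span dk nGk (submx_refl _).
    exact: orth_addsmx dB dG' vBG.
  rewrite XhE !mulmxDl.
  suff -> : u *m S *m v^T = 0 by rewrite add0r.
  by rewrite form_sym (orth_addsmx vA vG uAG) trmx0.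
have vv : v *m S *m v^T = 0.
  have hv : lam *m h *m S *m v^T = 0.
    rewrite form_sym (_ : _ *m _ = 0) ?trmx0//.
    have /submxP[D' ->] : (lam *m h <= span_mx G)%MS.
      exact: submx_trans (submxMl _ _) hG.
    by rewrite trmx_mul mulmxA vG mul0mx.
  by rewrite {1}/v mulmxBr !mulmxBl Xcv hv subrr.
have vS := psd_null vv.
(* [lam *m X c] differs from the null [v] by [lam *m h]. Pairing with the dual of an index j of G
   kills [v], and [X c] because j != c, so each coefficient of [lam *m h] vanishes. *)
have lh0 : lam *m h = 0.
  have /span_mxP[E EE] : (lam *m h <= span_mx G)%MS.
    exact: submx_trans (submxMl _ _) hG.
  rewrite EE big1// => j Gj.
  have jN : (j <= N)%N by rewrite -ltnS.
  have [dj jc] := dG _ jN Gj.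
  suff -> : E j = 0 by rewrite mul0mx.
  have : v *m S *m (Xh j)^T = 0 by rewrite vS mul0mx.
  rewrite /v mulmxBr EE !mulmxBl.
  have -> : lam *m X c *m S *m (Xh j)^T = 0.
    by rewrite -!mulmxA (mulmxA (X c)) form_sym dj// (negbTE jc) trmx0 mulmx0.
  rewrite sub0r !mulmx_suml (bigD1 j)//= big1 ?addr0.
    rewrite -!mulmxA (mulmxA (X j)) form_sym dj// eqxx trmx1 mulmx1 => /eqP.
    by rewrite oppr_eq0 => /eqP.
  move=> i /andP[_ ij]; rewrite -!mulmxA (mulmxA (X i)) form_sym dj//.
    by rewrite eq_sym (_ : (_ == _) = false) ?trmx0 ?mulmx0//; exact/negbTE.
  by rewrite -ltnS.
have : lam *m (X c *m S *m (X c)^T) = 0.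
  rewrite !mulmxA; suff -> : lam *m X c = v by rewrite vS mul0mx.
  by rewrite /v mulmxBr lh0 subr0.
by move=> /(congr1 (fun M => M *m invmx (X c *m S *m (X c)^T))); rewrite mulmxK// mul0mx.
Qed.

End dual.

(** * Chains driven by white noise, shifted by multiples of an end state *)

Section chain.
Variables (f l c r : nat) (Y E : nat -> 'M[R]_(d, n)).
Variables (Ut : nat -> nat -> 'M[R]_d) (U Gam : nat -> 'M[R]_d).
Hypothesis casesN : (2 <= N)%N /\
  ((c = 0%N /\ f = 1%N /\ l = N /\ r = 1%N) \/
   (c = N /\ f = 0%N /\ l = N.-1 /\ r = N.-1)).
Hypothesis covE : forall k j, (f <= k <= l)%N -> (f <= j <= l)%N ->
  E k *m S *m (E j)^T = if k == j then U k else 0.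
Hypothesis unitU : forall k, (f <= k <= l)%N -> U k \in unitmx.
Hypothesis unitXc : X c *m S *m (X c)^T \in unitmx.
Hypothesis covYc : forall k, (f <= k <= l)%N -> Y k *m S *m (X c)^T = 0.
Hypothesis Yf : Y f = E f.
Hypothesis YS : forall k, (f < k <= l)%N -> Y k = Ut k k.-1 *m Y k.-1 + E k.
Hypothesis XE : forall k, (f <= k <= l)%N -> X k = Y k + Gam k *m X c.

(** What [X c] contributes to X_k - U_{k,k-1} X_{k-1} beyond the noise. The index f has no
    predecessor in the chain: [f.-1] is c or f itself. *)
Definition chain_diff k := if k == f then Gam k else Gam k - Ut k k.-1 *m Gam k.-1.

(* The block rows of the inverse covariance of [X], applied to [X]. *)
Definition chain_dual k := invmx (U k) *m E k -
  (if (k < l)%N then (Ut k.+1 k)^T *m invmx (U k.+1) *m E k.+1 else 0).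

(** The opposite of the coefficient of [X c] in [chain_dual k]. For 0 < k < N and k != r its
    vanishing is the reciprocality condition, and at the end opposite to c it is the additional
    Markov condition. *)
Definition chain_coef k := invmx (U k) *m chain_diff k -
  (if (k < l)%N then (Ut k.+1 k)^T *m invmx (U k.+1) *m chain_diff k.+1 else 0).

Lemma chain_noise k : (f <= k <= l)%N ->
  E k = X k - (if k == f then 0 else Ut k k.-1 *m X k.-1) - chain_diff k *m X c.
Proof.
move=> kfl; rewrite /chain_diff; case: eqP => [->|kf].
  by rewrite subr0 XE ?Yf ?addrK//; lia.
rewrite XE// (YS (k := k)); last lia.
rewrite (XE (k := k.-1)); last lia.
rewrite mulmxDr mulmxBl mulmxA.
rewrite opprD opprB addrACA; apply/eqP; rewrite -subr_eq0; apply/eqP.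
by rewrite addrAC; apply/matrixP => i j; rewrite !mxE; ring.
Qed.

Lemma covEc k : (f <= k <= l)%N -> E k *m S *m (X c)^T = 0.
Proof.
move=> kfl; have [->|kf] := eqVneq k f; first by rewrite -Yf covYc//; lia.
have kf' : (f < k <= l)%N by lia.
have -> : E k = Y k - Ut k k.-1 *m Y k.-1 by rewrite (YS kf') addrAC subrr add0r.
rewrite !mulmxBl covYc// -!mulmxA (mulmxA (Y _)) covYc; last lia.
by rewrite mulmx0 subr0.
Qed.

Lemma chain_dual_noise k j : (f <= k <= l)%N -> (f <= j <= l)%N ->
  chain_dual k *m S *m (E j)^T =
  (if k == j then 1%:M else 0) - (if k.+1 == j then (Ut k.+1 k)^T else 0).
Proof.
move=> kfl jfl; rewrite /chain_dual !mulmxBl; congr (_ - _).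
  rewrite -!mulmxA (mulmxA (E k)) covE//; case: eqP => _; last by rewrite mulmx0.
  by rewrite mulVmx// unitU.
case: ifPn => [kl|kl]; last by rewrite !mul0mx; case: eqP => //; lia.
rewrite -!mulmxA (mulmxA (E _)) covE//; last lia.
case: eqP => _; last by rewrite !mulmx0.
by rewrite mulVmx ?mulmx1// unitU//; lia.
Qed.

(** The pairing with the noise has a second term at j = k + 1, which cancels the contribution of Y_k
    passed on by the recursion to Y_{k+1}. *)
Lemma chain_dual_state k j : (f <= k <= l)%N -> (f <= j <= l)%N ->
  chain_dual k *m S *m (Y j)^T = if k == j then 1%:M else 0.
Proof.
move=> kfl; elim: j => [|j IH] jfl.
  have f0 : f = 0%N by lia.
  rewrite -{1}f0 Yf chain_dual_noise//; last lia.
  by rewrite f0 (_ : (k.+1 == 0%N) = false)// subr0.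
have [fj|fj] := eqVneq f j.+1.
  rewrite -{1}fj Yf chain_dual_noise//; last lia.
  by rewrite fj (_ : (k.+1 == j.+1) = false) ?subr0//; lia.
rewrite (YS (k := j.+1)); last lia.
rewrite linearD/= mulmxDr trmx_mul mulmxA IH; last lia.
rewrite chain_dual_noise// eqSS; case: (eqVneq k j) => [->|kj].
  by rewrite mul1mx addrC subrK.
by rewrite mul0mx add0r subr0.
Qed.

Lemma chain_dual_at k : (f <= k <= l)%N -> dual_at chain_dual k.
Proof.
move=> kfl j jN.
have dc : chain_dual k *m S *m (X c)^T = 0.
  rewrite /chain_dual !mulmxBl -!mulmxA (mulmxA (E k)) covEc// mulmx0 sub0r.
  case: ifPn => [kl|_]; last by rewrite !mul0mx oppr0.
  by rewrite -!mulmxA (mulmxA (E k.+1)) covEc ?mulmx0 ?oppr0//; lia.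
have [->|jc] := eqVneq j c; first by rewrite dc; case: eqP => //; lia.
have jfl : (f <= j <= l)%N by lia.
rewrite XE// linearD/= mulmxDr chain_dual_state// trmx_mul mulmxA dc mul0mx.
by rewrite addr0.
Qed.

(** The noises E_k and E_{k+1} are rewritten through consecutive states. W stays arbitrary because
    the neighbours of k fall into different index sets for the two properties. *)
Lemma chain_dual_coef k p (W : 'M[R]_(p, n)) : (f <= k <= l)%N -> (X k <= W)%MS ->
  (k != f -> X k.-1 <= W)%MS -> ((k < l)%N -> X k.+1 <= W)%MS ->
  exists u : 'M[R]_(d, n), (u <= W)%MS /\
    chain_dual k = u + (- chain_coef k) *m X c.
Proof.
move=> kfl Wk Wp Ws.
exists (invmx (U k) *m (X k - (if k == f then 0 else Ut k k.-1 *m X k.-1)) -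
  (if (k < l)%N then (Ut k.+1 k)^T *m invmx (U k.+1) *m
     (X k.+1 - Ut k.+1 k *m X k) else 0)); split.
  rewrite addmx_sub ?eqmx_opp//.
    rewrite (submx_trans (submxMl _ _))// addmx_sub ?eqmx_opp//.
    case: ifPn => [_|/Wp kp]; first exact: sub0mx.
    exact: submx_trans (submxMl _ _) kp.
  case: ifPn => [/Ws ks|_]; last exact: sub0mx.
  rewrite (submx_trans (submxMl _ _))// addmx_sub ?eqmx_opp//.
  exact: submx_trans (submxMl _ _) Wk.
rewrite /chain_dual /chain_coef [in LHS](chain_noise kfl) mulNmx mulmxBl opprB.
move: (if k == f then 0 else _) => x0.
case: ifPn => [kl|_]; last first.
  by rewrite mul0mx !subr0 sub0r mulmxBr mulmxA.
rewrite (chain_noise (k := k.+1)); last lia.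
rewrite (_ : (k.+1 == f) = false); last lia.
rewrite /= !mulmxBr !mulmxA.
by apply/matrixP => i j; rewrite !mxE; ring.
Qed.

Lemma chain_dual_sub k p (W : 'M[R]_(p, n)) : (f <= k <= l)%N -> (X k <= W)%MS ->
  (k != f -> X k.-1 <= W)%MS -> ((k < l)%N -> X k.+1 <= W)%MS ->
  (chain_coef k = 0 \/ (X c <= W)%MS) -> (chain_dual k <= W)%MS.
Proof.
move=> kfl Wk Wp Ws Wc; have [u [uW ->]] := chain_dual_coef kfl Wk Wp Ws.
rewrite addmx_sub//; case: Wc => [->|Wc]; first by rewrite oppr0 mul0mx sub0mx.
exact: submx_trans (submxMl _ _) Wc.
Qed.

Let spanl A G k : (k <= N)%N -> A k -> (X k <= span_mx A + span_mx G)%MS.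
Proof. by move=> kN Ak; exact: submx_trans (sub_span_mx kN Ak) (addsmxSl _ _). Qed.

Let spanr A G k : (k <= N)%N -> G k -> (X k <= span_mx A + span_mx G)%MS.
Proof. by move=> kN Gk; exact: submx_trans (sub_span_mx kN Gk) (addsmxSr _ _). Qed.

Let spanlr A G k : (k <= N)%N -> A k || G k -> (X k <= span_mx A + span_mx G)%MS.
Proof. by move=> kN /orP[]; [exact: spanl|exact: spanr]. Qed.

Lemma chain_reciprocal :
  (forall i j, (i < j <= N)%N -> residual_orth (fun k => i < k < j)%N
     (fun k => (k < i) || (j < k))%N (pred2 i j)) <->
  (forall k, (1 <= k <= N.-1)%N -> k != r -> chain_coef k = 0).
Proof.
split=> [res k kN kr|coef0 i j ijN].
  have kfl : (f <= k <= l)%N by lia.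
  (* The smallest window around k has k alone inside, and k != r keeps c strictly outside it. *)
  have kk : (k.-1 < k.+1 <= N)%N by lia.
  set A := fun i => (k.-1 < i < k.+1)%N; set G := pred2 k.-1 k.+1.
  have [||| u [uW uE]] := @chain_dual_coef k _ (span_mx A + span_mx G)%MS kfl.
  - by apply: spanl; rewrite /A; lia.
  - by move=> ?; apply: spanr; rewrite /G/= ?eqxx//; lia.
  - by move=> ?; apply: spanr; rewrite /G/= ?eqxx ?orbT//; lia.
  apply/eqP; rewrite -oppr_eq0; apply/eqP.
  apply: (residual_orth_coef _ _ _ _ _ _ _ _ unitXc uW uE (res _ _ kk)).
  - lia.
  - lia.
  - by rewrite /A; lia.
  - lia.
  - lia.
  - by rewrite /G/=; lia.
  - exact: chain_dual_at.
  - move=> j jN; rewrite /G/= => jG; split; last lia.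
    by apply: chain_dual_at; lia.
apply: (@residual_orth_dual chain_dual) => [k kN ik|k kN ik].
  split; [apply: chain_dual_at| |]; rewrite /=; lia.
apply: chain_dual_sub; [lia|apply: spanlr|move=> _; apply: spanlr|
  move=> _; apply: spanlr|]; rewrite /=; try lia.
(* No condition is imposed at r, the neighbour of c: if r is inside the window, then c is one of its
   two ends, so [X c] is in the span of the conditioning states. *)
have [kr|kr] := eqVneq k r; last by left; apply: coef0; lia.
by right; apply: spanr; rewrite /=; lia.
Qed.

(** The expanded side is the one without c, that is the future if c = 0, where [residual_orthC]
    exchanges the roles, and the past if c = N. For necessity the cut is next to k in the direction
    of c, and k != r keeps it away from c itself. *)
Lemma chain_markov :
  (forall i, (i <= N)%N -> residual_orth (fun k => k < i)%N
     (fun k => i < k)%N (pred1 i)) <->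
  (forall k, (f <= k <= l)%N -> k != r -> chain_coef k = 0).
Proof.
split=> [res k kfl kr|coef0 i iN].
  case: casesN => N2 [[c0 [f1 [lN r1]]]|[cN [f0 [lN rN]]]].
  - have /residual_orthC res' : residual_orth (fun i => i < k.-1)%N
      (fun i => k.-1 < i)%N (pred1 k.-1) by apply: res; lia.
    have [||| u [uW uE]] := @chain_dual_coef k _
      (span_mx (fun i => k.-1 < i)%N + span_mx (pred1 k.-1))%MS kfl.
    + by apply: spanl; lia.
    + by move=> ?; apply: spanr; rewrite /= ?eqxx//; lia.
    + by move=> ?; apply: spanl; lia.
    apply/eqP; rewrite -oppr_eq0; apply/eqP.
    apply: (residual_orth_coef _ _ _ _ _ _ _ _ unitXc uW uE res') => /=; try lia.
    + exact: chain_dual_at.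
    + by move=> j jN jG; split; [apply: chain_dual_at|]; lia.
  - have res' : residual_orth (fun i => i < k.+1)%N
      (fun i => k.+1 < i)%N (pred1 k.+1) by apply: res; lia.
    have [||| u [uW uE]] := @chain_dual_coef k _
      (span_mx (fun i => i < k.+1)%N + span_mx (pred1 k.+1))%MS kfl.
    + by apply: spanl; lia.
    + by move=> ?; apply: spanl; lia.
    + by move=> ?; apply: spanr; rewrite /= ?eqxx//; lia.
    apply/eqP; rewrite -oppr_eq0; apply/eqP.
    apply: (residual_orth_coef _ _ _ _ _ _ _ _ unitXc uW uE res') => /=; try lia.
    + exact: chain_dual_at.
    + by move=> j jN jG; split; [apply: chain_dual_at|]; lia.
case: casesN => N2 [[c0 [f1 [lN r1]]]|[cN [f0 [lN rN]]]].
- apply: residual_orthC.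
  apply: (@residual_orth_dual chain_dual) => [k kN ik|k kN ik].
    split; [apply: chain_dual_at| |]; rewrite /=; lia.
  apply: chain_dual_sub; [lia|apply: spanlr|move=> ?; apply: spanlr|
    move=> ?; apply: spanlr|]; rewrite /=; try lia.
  have [kr|kr] := eqVneq k r; last by left; apply: coef0; lia.
  by right; apply: spanr; rewrite /=; lia.
- apply: (@residual_orth_dual chain_dual) => [k kN ik|k kN ik].
    split; [apply: chain_dual_at| |]; rewrite /=; lia.
  apply: chain_dual_sub; [lia|apply: spanlr|move=> ?; apply: spanlr|
    move=> ?; apply: spanlr|]; rewrite /=; try lia.
  have [kr|kr] := eqVneq k r; last by left; apply: coef0; lia.
  by right; apply: spanr; rewrite /=; lia.
Qed.

End chain.
End span.
End semidefinite_form.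

(** * Gaussian vectors *)

Section gaussian_vector.
Context (disp : measure_display) (T : measurableType disp) (R : realType).
Variables (P : probability T R) (n : nat) (Z : T -> 'cV[R]_n).
Hypotheses (gZ : gaussian_vec P Z) (Z0 : zero_mean P Z).

Definition lin_form (w : 'rV[R]_n) : T -> R := fun t => (w *m Z t) 0 0.

Definition lin_forms (M : 'M[R]_n) : set (T -> R) :=
  [set lin_form w | w in [set w | (w <= M)%MS]].

(** The covariance matrix of the centered vector Z, in the form that expands bilinearly over linear
    forms. *)
Definition moment_mx : 'M[R]_n := \matrix_(i, j) \int[P]_t (Z t i 0 * Z t j 0).

Lemma lin_formE w : lin_form w = fun t => \sum_i w 0 i * Z t i 0.
Proof. by apply/funext => t; rewrite /lin_form mxE. Qed.

Lemma lin_formD a w w' t : lin_form (a *: w + w') t = a * lin_form w t + lin_form w' t.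
Proof. by rewrite /lin_form mulmxDl -scalemxAl !mxE. Qed.

Lemma lin_form_delta i : lin_form (delta_mx 0 i) = fun t => Z t i 0.
Proof. by apply/funext => t; rewrite /lin_form -rowE mxE. Qed.

Let gi i : gaussian_rv P (fun t => Z t i 0).
Proof. by rewrite -lin_form_delta; exact: gZ. Qed.

Lemma gaussian_entry_integrable i : P.-integrable setT (EFin \o (fun t => Z t i 0)).
Proof.
have [m [s [s0 H]]] := gaussian_rv_integral (gi i).
have cid : continuous (id : R -> R) by move=> x; exact: cvg_id.
apply: (H _ cid).2; apply: integrableRD; first exact: integrable_cst.
exact/integrableRZ/normal_prob_id_integrable.
Qed.

Let EZ i : \int[P]_t Z t i 0 = 0.
Proof. by have := Z0 i; rewrite unlock /Rintegral => ->. Qed.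

Lemma gaussian_entry_mul_integrable i j :
  P.-integrable setT (EFin \o (fun t => Z t i 0 * Z t j 0)).
Proof.
have [si [_ _ _ i2 _]] := centered_gaussian_rv_integral (gi i) (EZ i).
have [sj [_ _ _ j2 _]] := centered_gaussian_rv_integral (gi j) (EZ j).
exact: integrable_sqr_mul (gi i).1 (gi j).1 i2 j2.
Qed.

Lemma integrable_sumR I (s : seq I) (F : I -> T -> R) :
  (forall i, P.-integrable setT (EFin \o F i)) ->
  P.-integrable setT (EFin \o (fun t => \sum_(i <- s) F i t)).
Proof.
move=> iF; elim: s => [|i s IH].
  by under eq_fun do rewrite big_nil; exact: integrable_cst.
by under eq_fun do rewrite big_cons; exact: integrableRD.
Qed.

Lemma Rintegral_sum I (s : seq I) (F : I -> T -> R) :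
  (forall i, P.-integrable setT (EFin \o F i)) ->
  \int[P]_t (\sum_(i <- s) F i t) = \sum_(i <- s) \int[P]_t F i t.
Proof.
move=> iF; elim: s => [|i s IH].
  by under eq_Rintegral do rewrite big_nil; rewrite Rintegral_prob_cst big_nil.
under eq_Rintegral do rewrite big_cons.
by rewrite RintegralD// ?IH ?big_cons//; exact: integrable_sumR.
Qed.

Lemma centered_gaussian_lin_forms : centered_gaussian_space P (lin_forms 1%:M).
Proof.
split; first split.
- exists 0; first exact: sub0mx.
  by apply/funext => t; rewrite /lin_form mul0mx mxE.
- by move=> _ [w _ <-]; have [] := gZ w.
- move=> a _ _ [w _ <-] [w' _ <-]; exists (a *: w + w'); first exact: submx1.
  by apply/funext => t; rewrite lin_formD.
move=> _ [w _ <-]; split; first exact: gZ.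
rewrite lin_formE Rintegral_sum; last first.
  by move=> i; apply: integrableRZ; exact: gaussian_entry_integrable.
apply: big1 => i _; rewrite RintegralZl ?EZ ?mulr0//.
exact: gaussian_entry_integrable.
Qed.

Lemma lin_forms_linear M : linear_space (lin_forms M).
Proof.
split.
- exists 0; first exact: sub0mx.
  by apply/funext => t; rewrite /lin_form mul0mx mxE.
- by move=> _ [w _ <-]; have [] := gZ w.
- move=> a _ _ [w wM <-] [w' wM' <-]; exists (a *: w + w').
    by rewrite /= addmx_sub// scalemx_sub.
  by apply/funext => t; rewrite lin_formD.
Qed.

Lemma lin_forms_sub M : lin_forms M `<=` lin_forms 1%:M.
Proof. by move=> _ [w _ <-]; exists w => //; exact: submx1. Qed.

Lemma lin_form_moment w w' :
  \int[P]_t (lin_form w t * lin_form w' t) = (w *m moment_mx *m w'^T) 0 0.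
Proof.
rewrite !lin_formE.
transitivity (\int[P]_t (\sum_i \sum_j (w 0 i * w' 0 j) * (Z t i 0 * Z t j 0))).
  apply: eq_Rintegral => t _; rewrite mulr_suml; apply: eq_bigr => i _.
  by rewrite mulr_sumr; apply: eq_bigr => j _; ring.
have iij i j : P.-integrable setT
    (EFin \o (fun t => (w 0 i * w' 0 j) * (Z t i 0 * Z t j 0))).
  by apply: integrableRZ; exact: gaussian_entry_mul_integrable.
rewrite Rintegral_sum; last by move=> i; exact: integrable_sumR.
rewrite -mulmxA mxE; apply: eq_bigr => i _.
rewrite Rintegral_sum// mxE mulr_sumr; apply: eq_bigr => j _.
rewrite RintegralZl//; last exact: gaussian_entry_mul_integrable.
by rewrite !mxE; ring.
Qed.

Lemma moment_mx_sym : moment_mx^T = moment_mx.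
Proof.
by apply/matrixP => i j; rewrite !mxE; apply: eq_Rintegral => t _; rewrite mulrC.
Qed.

Lemma moment_mx_psd (w : 'rV[R]_n) : 0 <= (w *m moment_mx *m w^T) 0 0.
Proof.
rewrite -lin_form_moment; apply: Rintegral_ge0 => t _.
by rewrite -expr2 sqr_ge0.
Qed.

Lemma cov_mx_moment p q (A : 'M[R]_(p, n)) (B : 'M[R]_(q, n)) :
  cov_mx P (fun t => A *m Z t) (fun t => B *m Z t) = A *m moment_mx *m B^T.
Proof.
have entryE r (C : 'M[R]_(r, n)) k : (fun t => (C *m Z t) k 0) = lin_form (row k C).
  by apply/funext => t; rewrite /lin_form -row_mul [RHS]mxE.
have mean0 w : ('E_P[lin_form w] = 0)%E.
  rewrite unlock integral_EFin_Rintegral.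
    by rewrite (centered_gaussian_lin_forms.2 _ _).2//; exists w => //; exact: submx1.
  rewrite lin_formE; apply: integrable_sumR => i; apply: integrableRZ.
  exact: gaussian_entry_integrable.
apply/matrixP => i j; rewrite mxE !entryE unlock !mean0/= unlock.
transitivity (\int[P]_t (lin_form (row i A) t * lin_form (row j B) t)).
  by congr fine; apply: eq_integral => t _; rewrite !fctE/= !subr0.
rewrite lin_form_moment -row_mul tr_row.
rewrite [RHS]mxE [LHS]mxE; apply: eq_bigr => k _.
by rewrite [row _ _ _ _]mxE [col _ _ _ _]mxE.
Qed.

Section spans.
Variables (N d : nat) (X : nat -> 'M[R]_(d, n)).
Local Notation span := (span_mx N X).
Local Notation res := (residual_orth moment_mx N X).

Lemma form_rowsP (v : 'rV[R]_n) (M : 'M[R]_n) :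
  v *m moment_mx *m M^T = 0 <->
  forall w : 'rV[R]_n, (w <= M)%MS -> (v *m moment_mx *m w^T) 0 0 = 0.
Proof.
split=> [vM w /submxP[D ->]|vM].
  by rewrite trmx_mul mulmxA vM mul0mx mxE.
apply/rowP => i; rewrite [RHS]mxE -(vM _ (row_sub i M)) tr_row colE mulmxA.
by rewrite -colE [RHS]mxE.
Qed.

Lemma residual_orthogonal_spanP (A B G : pred nat) :
  residual_orthogonal P (lin_forms (span A)) (lin_forms (span B)) (lin_forms (span G))
  <-> res A B G.
Proof.
have addE b g t : lin_form b t + lin_form g t = lin_form (b + g) t.
  by rewrite /lin_form mulmxDl [RHS]mxE.
split=> [ro v /sub_addsmxP[[Db Dg] /= vE] /form_rowsP vG|].
  apply/form_rowsP => a aA; rewrite -lin_form_moment; apply: ro.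
  - exists (lin_form (Db *m span B)), (lin_form (Dg *m span G)); split.
    + by exists (Db *m span B) => //; exact: submxMl.
    + by exists (Dg *m span G) => //; exact: submxMl.
    + by apply/funext => t; rewrite addE -vE.
  - by move=> _ [g gG <-]; rewrite lin_form_moment; exact: vG.
  - by exists a.
move=> ro _ [_ [_ [[b bB <-] [g gG <-] ->]]] vG _ [a aA <-].
under eq_Rintegral do rewrite addE; rewrite lin_form_moment.
have /form_rowsP : (b + g) *m moment_mx *m (span A)^T = 0.
  apply: ro.
    rewrite addmx_sub//; first exact: submx_trans bB (addsmxSl _ _).
    exact: submx_trans gG (addsmxSr _ _).
  apply/form_rowsP => u uG; rewrite -lin_form_moment -[RHS](vG (lin_form u)).
    by apply: eq_Rintegral => t _; rewrite addE.
  by exists u.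
by apply.
Qed.

(** In finite dimension [form_projection] supplies the projections that the converse direction asks
    for. *)
Lemma cond_indep_spanP (A B G : pred nat) :
  cond_indep P (sigma_of (lin_forms (span A))) (sigma_of (lin_forms (span B)))
    (sigma_of (lin_forms (span G))) <-> res A B G.
Proof.
split=> [ci|/residual_orthogonal_spanP ro].
  apply/residual_orthogonal_spanP.
  by apply: (cond_indep_residual centered_gaussian_lin_forms _ _ _ _ _ _ ci);
    do ?[exact: lin_forms_linear | exact: lin_forms_sub].
apply: (residual_cond_indep centered_gaussian_lin_forms _ _ _ _ _ _ _ ro);
  do ?[exact: lin_forms_linear | exact: lin_forms_sub].
move=> _ [b bB <-].
have [D DE] := form_projection moment_mx_sym moment_mx_psd (span G) b.
exists (lin_form (D *m span G)); split.
  by exists (D *m span G) => //; exact: submxMl.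
move=> _ [g gG <-].
transitivity (\int[P]_t (lin_form (b - D *m span G) t * lin_form g t)).
  apply: eq_Rintegral => t _; congr (_ * _).
  by rewrite /lin_form mulmxBl [RHS]mxE [X in _ = _ + X]mxE.
by rewrite lin_form_moment; exact: (form_rowsP _ _).1 DE _ gG.
Qed.

(** One side is generated by the entries of the states, the other by all linear forms in their span,
    which are finite combinations of these entries. *)
Lemma sigma_seq_span (x : nat -> T -> 'cV[R]_d) (J : pred nat) :
  (forall k t, (k <= N)%N -> x k t = X k *m Z t) ->
  sigma_seq [set k | k \in times N /\ J k] x = sigma_of (lin_forms (span J)).
Proof.
move=> xE; have timesE k : (k \in times N) = (k <= N)%N.
  by rewrite mem_index_iota ltnS.
rewrite eqEsubset; split.
  apply: smallest_sub; first exact: smallest_sigma_algebra.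
  move=> _ [k [kN Jk] [i _ [B mB <-]]]; rewrite timesE in kN.
  have -> : (fun t => x k t i 0) = lin_form (row i (X k)).
    by apply/funext => t; rewrite xE// /lin_form -row_mul [RHS]mxE.
  apply: sub_sigma_algebra; exists (lin_form (row i (X k))); last by exists B.
  exists (row i (X k)) => //; rewrite /= (submx_trans (row_sub _ _))//.
  exact: sub_span_mx.
rewrite /sigma_seq; set G := (X in _ `<=` <<s X >>).
pose TG := g_sigma_algebraType G.
apply: smallest_sub; first exact: smallest_sigma_algebra.
move=> _ [_ [w /span_mxP[D wE] <-] [B mB <-]].
have mx k i : (k <= N)%N -> J k -> measurable_fun setT ((fun t => x k t i 0) : TG -> R).
  move=> kN Jk _ E mE; rewrite setTI; apply: sub_sigma_algebra.
  exists k; first by rewrite /= timesE.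
  by exists i => //; exists E => //; rewrite setTI.
have mw : measurable_fun setT (lin_form w : TG -> R).
  rewrite (_ : lin_form w = (fun t => \sum_(k < N.+1 | J k) \sum_i
      D k 0 i * x k t i 0)); last first.
    apply/funext => t; rewrite /lin_form wE mulmx_suml summxE.
    by apply: eq_bigr => k Jk; rewrite -mulmxA -xE; [rewrite mxE|rewrite -ltnS].
  under eq_fun do rewrite big_mkcond/=.
  apply: measurable_sum => k; case: (boolP (J k)) => Jk; last exact: measurable_cst.
  apply: measurable_sum => i; apply: measurable_funM => //.
  by apply: mx => //; rewrite -ltnS.
exact: mw.
Qed.

End spans.
End gaussian_vector.

(** * Reading the hypotheses through one Gaussian vector *)

Lemma stack_entries (disp : measure_display) (T : measurableType disp)
    (R : realType) (d : nat) (s : seq nat) (y : nat -> T -> 'cV[R]_d) :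
  exists M : nat -> 'M[R]_(d, \sum_(p < size s) d),
    forall k : nat, k \in s -> forall t, y k t = M k *m stack s y t.
Proof.
(* The sum has a single term for k in s and is empty otherwise, which makes the block selector total
   in k. *)
exists (fun k => \sum_(p < size s | p == index k s :> nat)
  submxcol (p_ := fun=> d) 1%:M p) => k ks t.
have ps : (index k s < size s)%N by rewrite index_mem.
transitivity (submxcol (p_ := fun=> d) 1%:M (Ordinal ps) *m stack s y t).
  by rewrite submxcol_mul mul1mx mxcolK /= nth_index.
by congr (_ *m _); apply/esym; apply: big_pred1.
Qed.

Theorem proposition4p6 (R : realType) (disp : measure_display)
    (T : measurableType disp) (P : probability T R) (N d c a r : nat)
    (y e x : nat -> T -> 'cV[R]_d)
    (Utrans : nat -> nat -> 'M[R]_d) (U Gamma : nat -> 'M[R]_d) (Cc : 'M[R]_d)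
    (hN : (2 <= N)%N)
    (hcar : (c = 0%N /\ a = 1%N /\ r = 1%N) \/
            (c = N /\ a = N /\ r = N.-1))
    (hy_zmng : zmng_seq P (times_but N c) y)
    (hy_markov : markov_seq P (times_but N c) y)
    (hy_rec : forall k, (1 <= k <= N)%N -> k != a ->
       forall t, y k t = Utrans k k.-1 *m y k.-1 t + e k t)
    (he_white : white_zmng_seq P (times_but N c) e)
    (he_cov : forall k, k \in times_but N c -> cov_mx P (e k) (e k) = U k)
    (he_init0 : c = 0%N -> forall t, e 1%N t = y 1%N t)
    (he_initN : c = N -> forall t, e 0%N t = y 0%N t)
    (hxc_zmng : zmng P (x c))
    (hxc_cov : cov_mx P (x c) (x c) = Cc)
    (hxc_y_gaussian :
       gaussian_vec P (fun t => col_mx (x c t) (stack (times_but N c) y t)))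
    (hxc_y_uncorr : forall k, k \in times_but N c ->
       uncorrelated P (x c) (y k))
    (hx : forall k, k \in times_but N c ->
       forall t, x k t = y k t + Gamma k *m x c t) :
  let star := forall k, (1 <= k <= N.-1)%N -> k != r ->
    invmx (U k) *m (Gamma k - Utrans k k.-1 *m Gamma k.-1) =
    (Utrans k.+1 k)^T *m invmx (U k.+1) *m
      (Gamma k.+1 - Utrans k.+1 k *m Gamma k) in
  (reciprocal_seq P (times N) x <-> star) /\
  (markov_seq P (times N) x <->
     star /\
     (c = N ->
        invmx (U 0%N) *m Gamma 0%N =
        (Utrans 1%N 0%N)^T *m invmx (U 1%N) *m
          (Gamma 1%N - Utrans 1%N 0%N *m Gamma 0%N)) /\
     (c = 0%N -> Gamma N - Utrans N N.-1 *m Gamma N.-1 = 0)).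
Proof.
move=> star.
(* [f] and [l] are the first and last indices of y, so that both positions of c are treated at
   once. *)
have [f [l [casesN kfN]]] : exists f l : nat, ((2 <= N)%N /\
    ((c = 0%N /\ f = 1%N /\ l = N /\ r = 1%N) \/
     (c = N /\ f = 0%N /\ l = N.-1 /\ r = N.-1))) /\
    forall k : nat, ((k != c) && (k <= N) = (f <= k <= l))%N.
  case: hcar => [[-> [_ ->]]|[-> [_ ->]]]; [exists 1%N, N|exists 0%N, N.-1].
    by split; [split=> //; left|move=> k; lia].
  by split; [split=> //; right|move=> k; lia].
have timesE k : (k \in times N) = (k <= N)%N by rewrite mem_index_iota ltnS.
have times_butE k : (k \in times_but N c) = (f <= k <= l)%N.
  by rewrite mem_filter timesE kfN.
pose s := times_but N c.
pose Z t := col_mx (x c t) (stack s y t).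
have Z0 : zero_mean P Z.
  have [_ xc0 _] := hxc_zmng; have [_ y0 _] := hy_zmng.
  move=> i; case: (split_ordP i) => j ->.
    by under eq_fun do rewrite col_mxEu; exact: xc0.
  by under eq_fun do rewrite col_mxEd; exact: y0.
pose m := (d + \sum_(p < size s) d)%N.
have [M ME] := stack_entries s y.
pose Xc : 'M[R]_(d, m) := row_mx 1%:M 0.
pose Y k : 'M[R]_(d, m) := row_mx 0 (M k).
(* The noise is recovered from y by the recursion, so it is a linear image of [Z], which has no
   components for e. *)
pose E k := if k == f then Y k else Y k - Utrans k k.-1 *m Y k.-1.
pose X k := if k == c then Xc else Y k + Gamma k *m Xc.
have XcE t : x c t = Xc *m Z t by rewrite mul_row_col mul1mx mul0mx addr0.
have YE k t : (f <= k <= l)%N -> y k t = Y k *m Z t.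
  by rewrite -times_butE => ks; rewrite mul_row_col mul0mx add0r -ME.
have EE k t : (f <= k <= l)%N -> e k t = E k *m Z t.
  move=> kfl; rewrite /E; case: eqP => [kf|kf].
    rewrite -YE//; case: casesN => _ [[c0 [f1 _]]|[cN [f0 _]]].
      by rewrite kf f1 he_init0.
    by rewrite kf f0 he_initN.
  rewrite mulmxBl -mulmxA -!YE//; last lia.
  rewrite hy_rec; [|lia|lia].
  by rewrite addrAC subrr add0r.
have XE k t : (k <= N)%N -> x k t = X k *m Z t.
  move=> kN; rewrite /X; case: eqP => [->//|kc].
  have kfl : (f <= k <= l)%N by rewrite -kfN; lia.
  by rewrite mulmxDl -mulmxA -XcE -YE// hx// times_butE.
pose S := moment_mx P Z.
have symS : S^T = S := moment_mx_sym P Z.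
have psdS := moment_mx_psd hxc_y_gaussian Z0.
have covE p q (A : 'M[R]_(p, m)) (B : 'M[R]_(q, m)) (u : T -> 'cV[R]_p) (v : T -> 'cV[R]_q) :
    (forall t, u t = A *m Z t) -> (forall t, v t = B *m Z t) ->
    cov_mx P u v = A *m S *m B^T.
  move=> uE vE; rewrite -(cov_mx_moment hxc_y_gaussian Z0); congr cov_mx;
    by apply/funext => t.
have covEE k j : (f <= k <= l)%N -> (f <= j <= l)%N ->
    E k *m S *m (E j)^T = if k == j then U k else 0.
  move=> kfl jfl; rewrite -(covE _ _ _ _ (e k) (e j)); last 2 first.
  - by move=> t; exact: EE.
  - by move=> t; exact: EE.
  case: eqP => [<-|/eqP kj]; first by apply: he_cov; rewrite times_butE.
  by have [_ _ + _] := he_white; apply; rewrite ?times_butE.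
have unitU k : (f <= k <= l)%N -> U k \in unitmx.
  move=> kfl; rewrite -he_cov ?times_butE//.
  by have [_ _ _] := he_white; apply; rewrite times_butE.
have Xcc : X c = Xc by rewrite /X eqxx.
have unitXc : X c *m S *m (X c)^T \in unitmx.
  rewrite -(covE _ _ _ _ (x c) (x c)); first by have [] := hxc_zmng.
  - by move=> t; apply: XE; lia.
  - by move=> t; apply: XE; lia.
have covYc k : (f <= k <= l)%N -> Y k *m S *m (X c)^T = 0.
  move=> kfl; rewrite form_sym// -(covE _ _ _ _ (x c) (y k)).
  - by rewrite hxc_y_uncorr ?trmx0 ?times_butE.
  - by move=> t; apply: XE; lia.
  - by move=> t; exact: YE.
have Yf : Y f = E f by rewrite /E eqxx.
have YS k : (f < k <= l)%N -> Y k = Utrans k k.-1 *m Y k.-1 + E k.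
  move=> kfl; rewrite /E (_ : (k == f) = false); last lia.
  by rewrite addrC subrK.
have Xfl k : (f <= k <= l)%N -> X k = Y k + Gamma k *m X c.
  by move=> kfl; rewrite Xcc /X (_ : (k == c) = false)//; move: (kfN k); lia.
have rec_eq := chain_reciprocal symS psdS casesN covEE unitU unitXc covYc Yf YS Xfl.
have mar_eq := chain_markov symS psdS casesN covEE unitU unitXc covYc Yf YS Xfl.
have ci (A B G : pred nat) := cond_indep_spanP hxc_y_gaussian Z0 N X A B G.
have sig (D : set nat) (J : pred nat) : (forall k, D k <-> (k <= N)%N /\ J k) ->
    sigma_seq D x = sigma_of (lin_forms Z (span_mx N X J)).
  move=> DJ; rewrite -(sigma_seq_span (x := x))//; congr sigma_seq.
  by apply/seteqP; split=> k; rewrite /= timesE DJ.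
have coefE k : (1 <= k <= N.-1)%N -> k != r ->
    chain_coef f l Utrans U Gamma k = 0 <->
    invmx (U k) *m (Gamma k - Utrans k k.-1 *m Gamma k.-1) =
    (Utrans k.+1 k)^T *m invmx (U k.+1) *m
      (Gamma k.+1 - Utrans k.+1 k *m Gamma k).
  move=> kN kr; rewrite /chain_coef /chain_diff.
  rewrite (_ : (k == f) = false); last lia.
  rewrite (_ : (k < l)%N); last lia.
  rewrite (_ : (k.+1 == f) = false); last lia.
  by split=> [/eqP|->]; rewrite ?subrr// subr_eq0 => /eqP.
have reciprocalE : reciprocal_seq P (times N) x <->
    (forall k, (1 <= k <= N.-1)%N -> k != r -> chain_coef f l Utrans U Gamma k = 0).
  have ciE i j : (i < j <= N)%N ->
      cond_indep P (sigma_seq [set k | k \in times N /\ (i < k < j)%N] x)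
        (sigma_seq [set k | k \in times N /\ ((k < i)%N \/ (j < k)%N)] x)
        (sigma_seq [set i; j] x) <->
      residual_orth S N X (fun k => i < k < j)%N
        (fun k => (k < i) || (j < k))%N (pred2 i j).
    move=> ijN; rewrite -ci (sig _ (fun k => i < k < j)%N).
      rewrite (sig _ (fun k => (k < i) || (j < k))%N).
        by rewrite (sig _ (pred2 i j))// => k /=; lia.
      by move=> k; rewrite /= timesE; split=> -[? /orP].
    by move=> k; rewrite /= timesE.
  rewrite -rec_eq; split=> rs i j.
    by move=> ijN; apply/ciE => //; apply: rs; rewrite ?timesE; lia.
  by rewrite !timesE => iN jN ij; apply/ciE; [lia|apply: rs; lia].
have markovE : markov_seq P (times N) x <->
    (forall k, (f <= k <= l)%N -> k != r -> chain_coef f l Utrans U Gamma k = 0).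
  have ciE i : (i <= N)%N ->
      cond_indep P (sigma_seq [set k | k \in times N /\ (k < i)%N] x)
        (sigma_seq [set k | k \in times N /\ (i < k)%N] x)
        (sigma_seq [set i] x) <->
      residual_orth S N X (fun k => k < i)%N (fun k => i < k)%N (pred1 i).
    move=> iN; rewrite -ci (sig _ (fun k => k < i)%N).
      rewrite (sig _ (fun k => i < k)%N).
        by rewrite (sig _ (pred1 i))// => k /=; lia.
      by move=> k; rewrite /= timesE.
    by move=> k; rewrite /= timesE.
  rewrite -mar_eq; split=> ms i; first by move=> iN; apply/ciE => //; apply: ms; rewrite timesE.
  by rewrite timesE => iN; apply/ciE => //; exact: ms.
have coef0E : c = N -> chain_coef f l Utrans U Gamma 0 = 0 <->
    invmx (U 0%N) *m Gamma 0%N =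
    (Utrans 1%N 0%N)^T *m invmx (U 1%N) *m (Gamma 1%N - Utrans 1%N 0%N *m Gamma 0%N).
  move=> cN; have [f0 l0] : f = 0%N /\ (0 < l)%N by lia.
  rewrite /chain_coef /chain_diff f0 l0/=.
  by split=> [/eqP|->]; rewrite ?subrr// subr_eq0 => /eqP.
have coefNE : c = 0%N -> chain_coef f l Utrans U Gamma N = 0 <->
    Gamma N - Utrans N N.-1 *m Gamma N.-1 = 0.
  move=> c0; have uN : U N \in unitmx by apply: unitU; lia.
  rewrite /chain_coef /chain_diff.
  rewrite (_ : (N == f) = false); last lia.
  rewrite (_ : (N < l)%N = false); last lia.
  (* N is the last index, so only the first term of the coefficient is left, and the invertible U_N
     cancels. *)
  rewrite subr0; split=> [H|->]; last by rewrite mulmx0.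
  by rewrite -[LHS](mulKVmx uN) H mulmx0.
split.
  rewrite reciprocalE; split=> H k kN kr; [apply/coefE|apply/coefE] => //; exact: H.
rewrite markovE; split=> [H|[Hs [HN H0]] k kfl kr].
  split; first by move=> k kN kr; apply/coefE => //; apply: H => //; lia.
  by split=> cE; [apply/coef0E => //|apply/coefNE => //]; apply: H; lia.
have [kN|kN] := boolP (1 <= k <= N.-1)%N; first by apply/coefE => //; exact: Hs.
(* Apart from the inner indices, only the end opposite to c remains. *)
have [[k0 cN]|[k0 c0]] : (k = 0%N /\ c = N) \/ (k = N /\ c = 0%N) by lia.
  by rewrite k0; apply/coef0E => //; exact: HN.
by rewrite k0; apply/coefNE => //; exact: H0.
Qed.
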